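(* There is a universal constant $C>0$ such that the following holds. Consider any $K$-armed bandit problem ($K\ge2$) whose reward distributions all belong to a known one-parameter exponential family $\mathcal F_m$ such that the log-partition function $b$ is twice differentiable with continuous second derivative $b''>0$ on $\Theta$, and such that every distribution in $\mathcal F_m$ has variance at most $\bar V$. Then the algorithm Exp-KL-MS, run for $T$ rounds, satisfies $$\mathrm{Reg}(T)\le C\Big(\sqrt{\bar V\,K\,T\ln K}+\sum_{a\in[K]}\Delta_a\Big),$$ where $\Delta_a=\mu_{\max}-\mu_a$.
   Context: Exponential family: given a base measure $m$ on $\mathbb R$, $\mathcal F_m=\{p_\theta(dx)=m(dx)\exp(x\theta-b(\theta)):\theta\in\Theta\}$, where $\Theta\subset\mathbb R$ is an interval and $b(\theta)=\ln\int_{\mathbb R}e^{x\theta}m(dx)$. Members are determined by their mean $b'(\theta)$. $\mathrm{KL}(\mu,\mu')$ denotes the Kullback–Leibler divergence $\mathbb E_{X\sim\nu}[\ln\frac{d\nu}{d\nu'}(X)]$ between the members $\nu,\nu'$ of $\mathcal F_m$ with means $\mu,\mu'$. Bandit: each arm $a\in[K]=\{1,\dots,K\}$ has reward distribution $\nu_a\in\mathcal F_m$ with mean $\mu_a$; $\mu_{\max}=\max_a\mu_a$. In round $t=1,\dots,T$ the agent picks $I_t\in[K]$ (based on the past and internal randomness) and receives $r_t\sim\nu_{I_t}$, independent of the past given $I_t$. $N_{t,a}=\sum_{i\le t}\mathbf 1\{I_i=a\}$, $\hat\mu_{t,a}=\frac1{N_{t,a}}\sum_{i\le t}r_i\mathbf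 1\{I_i=a\}$, $\hat\mu_{t,\max}=\max_a\hat\mu_{t,a}$. It is assumed that empirical means are means of members of $\mathcal F_m$. Regret: $\mathrm{Reg}(T)=\mathbb E\big[\sum_{t=1}^T(\mu_{\max}-\mu_{I_t})\big]$. Exp-KL-MS: in rounds $t\le K$ pull $I_t=t$; in each round $t>K$ pull $I_t=a$ with probability $p_{t,a}=\exp\!\big(-L(N_{t-1,a})\,\mathrm{KL}(\hat\mu_{t-1,a},\hat\mu_{t-1,\max})\big)/M_t$, where $L(k)=k-1$ and $M_t$ normalizes the probabilities to sum to $1$. *)

(* Defs.v *)
From mathcomp Require Export all_boot all_order all_algebra.
From mathcomp Require Export all_classical all_reals all_analysis.
Export numFieldNormedType.Exports.

Set Implicit Arguments.
Unset Strict Implicit.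
Unset Printing Implicit Defensive.
Import Order.TTheory GRing.Theory Num.Theory.

Local Open Scope classical_set_scope.
Local Open Scope ring_scope.
Local Open Scope charge_scope.

(* Derivative relative to a set, so that it also makes sense (as a one-sided
   derivative) at an endpoint of an interval; at interior points of [D] this is
   the usual derivative. *)
Definition diff_quotient_within {R : realType} (D : set R) (f : R -> R)
    (x : R) : set_system R :=
  (fun y => (f y - f x) / (y - x)) @ within D x^'.

Definition derivable_within {R : realType} (D : set R) (f : R -> R) (x : R) :=
  cvg (diff_quotient_within D f x).

Definition derive_within {R : realType} (D : set R) (f : R -> R) (x : R) : R :=
  lim (diff_quotient_within D f x).

Definition partition_fun {R : realType}
    (m : {measure set (measurableTypeR R) -> \bar R}) (theta : R) : \bar R :=
  (\int[m]_x (expR (x * theta))%:E)%E.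

(* Junk value [ln 0 = 0] where the partition function is infinite. *)
Definition log_partition {R : realType}
    (m : {measure set (measurableTypeR R) -> \bar R}) (theta : R) : R :=
  ln (fine (partition_fun m theta)).

(* The probability measures m(dx) exp(x theta - b(theta)), theta in Theta. *)
Definition exp_family {R : realType}
    (m : {measure set (measurableTypeR R) -> \bar R}) (Theta : set R)
    : set (probability (measurableTypeR R) R) :=
  [set q | exists2 theta, Theta theta &
     forall A, measurable A ->
       (q A = \int[m]_(x in A) (expR (x * theta - log_partition m theta))%:E)%E].

Definition mean {R : realType} (q : probability (measurableTypeR R) R) : R :=
  fine ('E_q[(fun x => x)])%E.

(* E_{X ~ p}[ln (dp/dq)(X)]; the Radon-Nikodym derivative is only meaningful
   when p << q, which always holds between members of an exponential family. *)
Definition KL_div {R : realType} (p q : probability (measurableTypeR R) R)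
    : \bar R :=
  (\int[p]_x lne ('d (charge_of_finite_measure p) '/d q x))%E.

Definition member_of_mean {R : realType}
    (m : {measure set (measurableTypeR R) -> \bar R}) (Theta : set R) (mu : R)
    : probability (measurableTypeR R) R :=
  get [set q | exp_family m Theta q /\ mean q = mu].

Definition KL {R : realType}
    (m : {measure set (measurableTypeR R) -> \bar R}) (Theta : set R)
    (mu mu' : R) : R :=
  fine (KL_div (member_of_mean m Theta mu) (member_of_mean m Theta mu')).

(* The bottom element -oo is never the result, since K > 0. *)
Definition max_arm {R : realType} {K : nat} (f : 'I_K -> R) : R :=
  fine (\big[maxe/-oo%E]_(a < K) (f a)%:E).

Definition gap {R : realType} {K : nat}
    (nu : 'I_K -> probability (measurableTypeR R) R) (a : 'I_K) : R :=
  max_arm (fun a' => mean (nu a')) - mean (nu a).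

(* Rounds are numbered from 1, the arms are the ordinals 0, ..., K - 1. *)

Definition pull_count {Omega : Type} {K : nat} (I : nat -> Omega -> 'I_K)
    (t : nat) (a : 'I_K) (w : Omega) : nat :=
  (\sum_(1 <= i < t.+1) (I i w == a))%N.

Definition emp_mean {R : realType} {Omega : Type} {K : nat}
    (I : nat -> Omega -> 'I_K) (r : nat -> Omega -> R)
    (t : nat) (a : 'I_K) (w : Omega) : R :=
  (\sum_(1 <= i < t.+1 | I i w == a) r i w) / (pull_count I t a w)%:R.

Definition emp_mean_max {R : realType} {Omega : Type} {K : nat}
    (I : nat -> Omega -> 'I_K) (r : nat -> Omega -> R)
    (t : nat) (w : Omega) : R :=
  max_arm (fun a => emp_mean I r t a w).

(* The sigma-algebra generated by I_1, r_1, ..., I_t, r_t. *)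
Definition history {R : realType} {Omega : Type} {K : nat}
    (I : nat -> Omega -> 'I_K) (r : nat -> Omega -> R) (t : nat)
    : set (set Omega) :=
  <<s [set A | exists2 i, (1 <= i <= t)%N &
         (exists a : 'I_K, A = I i @^-1` [set a]) \/
         (exists2 B : set (measurableTypeR R),
            measurable B & A = r i @^-1` B)] >>.

(* Given the past and I_t, the reward r_t has law nu_{I_t}: for every past
   event H, P(H, I_t = a, r_t in B) = P(H, I_t = a) nu_a(B). *)
Definition bandit_interaction {R : realType} {d : measure_display}
    {Omega : measurableType d} (P : probability Omega R) {K : nat}
    (nu : 'I_K -> probability (measurableTypeR R) R) (T : nat)
    (I : nat -> Omega -> 'I_K) (r : nat -> Omega -> R) : Prop :=
  forall t, (1 <= t <= T)%N ->
  [/\ forall a, measurable (I t @^-1` [set a]),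
      measurable_fun [set: Omega] (r t) &
      forall (H : set Omega) (a : 'I_K) (B : set (measurableTypeR R)),
        history I r t.-1 H -> measurable B ->
        (P (H `&` (I t @^-1` [set a]) `&` (r t @^-1` B)) =
         P (H `&` (I t @^-1` [set a])) * nu a B)%E].

Definition exp_KL_MS_weight {R : realType}
    (m : {measure set (measurableTypeR R) -> \bar R}) (Theta : set R)
    {Omega : Type} {K : nat}
    (I : nat -> Omega -> 'I_K) (r : nat -> Omega -> R)
    (t : nat) (a : 'I_K) (w : Omega) : R :=
  expR (- (((pull_count I t.-1 a w)%:R - 1) *
           KL m Theta (emp_mean I r t.-1 a w) (emp_mean_max I r t.-1 w))).

Definition exp_KL_MS_prob {R : realType}
    (m : {measure set (measurableTypeR R) -> \bar R}) (Theta : set R)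
    {Omega : Type} {K : nat}
    (I : nat -> Omega -> 'I_K) (r : nat -> Omega -> R)
    (t : nat) (a : 'I_K) (w : Omega) : R :=
  exp_KL_MS_weight m Theta I r t a w /
  \sum_(a' < K) exp_KL_MS_weight m Theta I r t a' w.

(* In rounds t > K, P(I_t = a | past) = p_{t,a}, stated as the defining property
   of the conditional probability given the history of the first t - 1 rounds. *)
Definition follows_exp_KL_MS {R : realType}
    (m : {measure set (measurableTypeR R) -> \bar R}) (Theta : set R)
    {d : measure_display} {Omega : measurableType d} (P : probability Omega R)
    {K : nat} (T : nat)
    (I : nat -> Omega -> 'I_K) (r : nat -> Omega -> R) : Prop :=
  (forall t w, (1 <= t <= T)%N -> (t <= K)%N -> I t w = t.-1 :> nat) /\
  (forall t (H : set Omega) (a : 'I_K),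
     (1 <= t <= T)%N -> (K < t)%N -> history I r t.-1 H ->
     (P (H `&` (I t @^-1` [set a])) =
      \int[P]_(w in H) (exp_KL_MS_prob m Theta I r t a w)%:E)%E).

Definition emp_means_in_family {R : realType}
    (m : {measure set (measurableTypeR R) -> \bar R}) (Theta : set R)
    {d : measure_display} {Omega : measurableType d} (P : probability Omega R)
    {K : nat} (T : nat)
    (I : nat -> Omega -> 'I_K) (r : nat -> Omega -> R) : Prop :=
  {ae P, forall w, forall t a, (1 <= t <= T)%N -> (0 < pull_count I t a w)%N ->
     exists2 q, exp_family m Theta q & mean q = emp_mean I r t a w}.

Definition regret {R : realType} {d : measure_display}
    {Omega : measurableType d} (P : probability Omega R) {K : nat}
    (nu : 'I_K -> probability (measurableTypeR R) R) (T : nat)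
    (I : nat -> Omega -> 'I_K) : \bar R :=
  ('E_P[(fun w => (\sum_(1 <= t < T.+1) gap nu (I t w))%R)])%E.

(* Main.v *)
Require Import Defs.
From HB Require Import structures.
From mathcomp Require Import measurable_realfun lra ring zify.

Set Implicit Arguments.
Unset Strict Implicit.
Unset Printing Implicit Defensive.
Import Order.TTheory GRing.Theory Num.Theory.
Local Open Scope classical_set_scope.
Local Open Scope ring_scope.

(** Write [b] for the log-partition function, [mu_t] for the mean at parameter
    [t], and [KL = b(t') - b(t) - mu_t (t' - t)].

    Only convexity of [b] and the variance bound enter.  Integrating
    [y (exp y - 1) <= y^2 (exp y + 1)] against one member of the family, with
    [y = (s - t) (x - c)] and [c] the point where the densities at [s] and [t]
    cross, shows that the mean is [4 V]-Lipschitz in the parameter; convexity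
    then gives [(mu - mu')^2 <= 16 V KL(mu, mu')].

    The process [exp (l S_t - k N_t)], where [S_t] and [N_t] are the cumulated
    reward and the number of pulls of an arm, is a martingale, and Ville's
    inequality gives [P(muhat <= x at some time with N >= n) <=
    exp(- n KL(x, mu))].

    For an arm [a] of gap [D], put [eps = D / 4], [e = eps^2 / (16 V)] and
    [tau = T e].  Its pulls are split according to whether (1) it has been
    pulled at most [u ~ ln tau / e] times, (2) its empirical mean exceeds
    [mu_a + eps], (3) neither, and the best empirical mean exceeds
    [y = mu_max - eps], or (4) the best empirical mean is at most [y].  Case (2)
    sums to [1 / e] and case (3) to [T exp (- u e) <= 1 / e].  In case (4), when
    an optimal arm [s] has been pulled [k] times, [a] is at most
    [exp (k KL(muhat_s, y))] times as likely to be pulled as [s], while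
    [P(k KL(muhat_s, y) > v) <= exp (- v - k e)] and [s] is pulled at most once
    with count [k]; so every unit interval of values of [k KL(muhat_s, y)]
    contributes [O(exp (- k e))].  Intervals are used up to a level [L_j] that
    is constant for [k] in [[2^j, 2^(j+1))]; beyond it, Ville's inequality over
    the whole dyadic block is used instead, which replaces [ln T] by [ln tau].
    The expected number of pulls is thus [O(1 + (1 + ln tau) / e)], and arms with
    [D <= 16 sqrt (V K ln K / T)] cost at most [16 sqrt (V K T ln K)] in total. *)

(** * Integrals against a density, exponential tilting *)

Section density.
Context d (X : measurableType d) (R : realType).
Variables (mu nu : {measure set X -> \bar R}) (g : X -> R).
Hypothesis g0 : forall x, 0 <= g x.
Hypothesis mg : measurable_fun setT g.
Hypothesis nuE : forall A, measurable A -> nu A = (\int[mu]_(x in A) (g x)%:E)%E.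
Import HBNNSimple.
Local Open Scope ereal_scope.

Let mgE : measurable_fun setT (fun x => (g x)%:E).
Proof. exact/measurable_EFinP. Qed.

(** Linearity reduces the claim to indicators, where it is [nuE]; [ge0_integral_density] then passes
    to the limit by monotone convergence. *)
Let nnsfun_density (h : {nnsfun X >-> R}) :
  \int[nu]_x (h x)%:E = \int[mu]_x ((h x)%:E * (g x)%:E).
Proof.
under eq_integral do rewrite fimfunE -fsumEFin//.
have mh r : measurable (h @^-1` [set r]).
  by rewrite -[X in measurable X]setTI; exact: measurable_funP.
have mind r : measurable_fun setT (fun x => (r * \1_(h @^-1` [set r]) x)%:E).
  by apply/measurable_EFinP; apply: measurable_funM => //; exact: measurable_indic.
rewrite ge0_integral_fsum//; last by move=> r x _; exact: nnfun_muleindic_ge0.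
transitivity (\int[mu]_x (\sum_(r \in range h)
    (r * \1_(h @^-1` [set r]) x)%:E * (g x)%:E)); last first.
  apply: eq_integral => x _; rewrite -ge0_mule_fsuml.
    by rewrite fsumEFin// -fimfunE.
  by move=> r; exact: nnfun_muleindic_ge0.
rewrite ge0_integral_fsum//; last 2 first.
- by move=> r; exact: emeasurable_funM.
- by move=> r x _; rewrite mule_ge0 ?lee_fin//; exact: nnfun_muleindic_ge0.
apply: eq_fsbigr => r /set_mem[t _ <-].
under [LHS]eq_integral do rewrite EFinM.
rewrite ge0_integralZl//; last 2 first.
- by apply/measurable_EFinP; exact: measurable_indic.
- by rewrite lee_fin.
rewrite integral_indic// setIT nuE//.
under [RHS]eq_integral do rewrite EFinM -muleA.
rewrite ge0_integralZl//; last 3 first.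
- by apply: emeasurable_funM => //; apply/measurable_EFinP; exact: measurable_indic.
- by move=> x _; rewrite mule_ge0 ?lee_fin.
- by rewrite lee_fin.
congr (_ * _); rewrite integral_mkcond; apply: eq_integral => x _.
by rewrite epatch_indic muleC.
Qed.

Lemma ge0_integral_density f : (forall x, 0 <= f x) -> measurable_fun setT f ->
  \int[nu]_x f x = \int[mu]_x (f x * (g x)%:E).
Proof.
move=> f0 mf; pose h := nnsfun_approx measurableT mf.
have hf x : f x = limn (fun n => (h n x)%:E).
  by apply/esym/cvg_lim => //; exact: (@cvg_nnsfun_approx _ _ _ _ _ _ mf).
have ndh x m n : (m <= n)%N -> (h m x <= h n x)%R.
  by move=> mn; exact/lefP/nd_nnsfun_approx.
have -> : \int[nu]_x f x = limn (fun n => \int[nu]_x (h n x)%:E).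
  under eq_integral => x _ do rewrite hf.
  apply: monotone_convergence => //.
  - by move=> n; exact/measurable_EFinP.
  - by move=> n x _; rewrite lee_fin.
  - by move=> x _ m n mn; rewrite lee_fin ndh.
have -> : \int[mu]_x (f x * (g x)%:E) =
    limn (fun n => \int[mu]_x ((h n x)%:E * (g x)%:E)).
  have hfg x : f x * (g x)%:E = limn (fun n => (h n x)%:E * (g x)%:E).
    apply/esym/cvg_lim => //; apply: cvgeZr => //.
    exact: (@cvg_nnsfun_approx _ _ _ _ _ _ mf).
  under eq_integral => x _ do rewrite hfg.
  apply: monotone_convergence => //.
  - by move=> n; apply: emeasurable_funM => //; exact/measurable_EFinP.
  - by move=> n x _; rewrite mule_ge0 ?lee_fin.
  - by move=> x _ m n mn; rewrite lee_wpmul2r ?lee_fin ?ndh.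
by under eq_fun do rewrite nnsfun_density.
Qed.

Lemma integral_density f : measurable_fun setT f ->
  \int[nu]_x f x = \int[mu]_x (f x * (g x)%:E).
Proof.
move=> mf; rewrite integralE [RHS]integralE.
rewrite !ge0_integral_density//; last 2 first.
- exact: measurable_funeneg.
- exact: measurable_funepos.
congr (_ - _); apply: eq_integral => x _.
  by rewrite !funeposE maxe_pMl ?lee_fin// mul0e.
by rewrite !funenegE -mulNe maxe_pMl ?lee_fin// mul0e.
Qed.

Lemma integrable_density f : nu.-integrable setT f ->
  mu.-integrable setT (fun x => f x * (g x)%:E).
Proof.
move=> /integrableP[mf foo]; apply/integrableP; split.
  exact: emeasurable_funM.
under eq_integral do rewrite abseM (gee0_abs (x := (g _)%:E)) ?lee_fin//.
by rewrite -ge0_integral_density//; exact: measurableT_comp.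
Qed.

End density.

Lemma Rintegral_density d (X : measurableType d) (R : realType)
    (mu nu : {measure set X -> \bar R}) (g : X -> R) :
  (forall x, 0 <= g x) -> measurable_fun setT g ->
  (forall A, measurable A -> nu A = (\int[mu]_(x in A) (g x)%:E)%E) ->
  forall f, measurable_fun setT f ->
  \int[nu]_x f x = \int[mu]_x (f x * g x).
Proof.
move=> g0 mg nuE f mf; rewrite /Rintegral (integral_density g0 mg nuE)//.
exact/measurable_EFinP.
Qed.

Section integrable_EFin.
Context d (X : measurableType d) (R : realType) (mu : {measure set X -> \bar R}).
Implicit Types f g : X -> R.

Lemma integrable_EFinD f g : mu.-integrable setT (EFin \o f) ->
  mu.-integrable setT (EFin \o g) ->
  mu.-integrable setT (EFin \o (fun x => f x + g x)).
Proof. by move=> fi gi; apply: (integrableD measurableT fi gi). Qed.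

Lemma integrable_EFinB f g : mu.-integrable setT (EFin \o f) ->
  mu.-integrable setT (EFin \o g) ->
  mu.-integrable setT (EFin \o (fun x => f x - g x)).
Proof. by move=> fi gi; apply: (integrableB measurableT fi gi). Qed.

Lemma integrable_EFinZ c f : mu.-integrable setT (EFin \o f) ->
  mu.-integrable setT (EFin \o (fun x => c * f x)).
Proof. by move=> fi; apply: (integrableZl measurableT c fi). Qed.

End integrable_EFin.

Lemma integrable_cst_prob d (X : measurableType d) (R : realType)
    (q : probability X R) c : q.-integrable setT (EFin \o (fun=> c)).
Proof. exact: finite_measure_integrable_cst. Qed.

Lemma Rintegral_cst_prob d (X : measurableType d) (R : realType)
    (q : probability X R) (c : R) : \int[q]_x c = c.
Proof. by rewrite Rintegral_cst// [X in fine X]probability_setT mulr1. Qed.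

(** * Moments under a variance bound *)

Section mean_variance.
Context (R : realType) (q : probability (measurableTypeR R) R) (V : R).
Hypothesis varq : ('V_q[(fun x => x)] <= V%:E)%E.

Let mid : measurable_fun setT (fun x : measurableTypeR R => x).
Proof. by []. Qed.

Let msq c : measurable_fun setT (fun x : measurableTypeR R => (x - c) ^+ 2).
Proof. by apply: measurable_funX; apply: measurable_funB. Qed.

Let var_int : (\int[q]_x ((x - mean q) ^+ 2)%:E <= V%:E)%E.
Proof.
by move: varq; rewrite /variance covariance.unlock /mean expectation.unlock.
Qed.

Let integrable_sq0 :
  q.-integrable setT (fun x : measurableTypeR R => ((x - mean q) ^+ 2)%:E).
Proof.
apply/integrableP; split; first exact/measurable_EFinP.
under eq_integral do rewrite gee0_abs ?lee_fin ?sqr_ge0//.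
by rewrite (le_lt_trans var_int)// ltry.
Qed.

(** The variance is centred at the real number [mean q], which is defined before integrability is
    known; its finiteness controls [x] through [|x| <= (x - mean q)^2 + 1 + |mean q|]. *)
Lemma integrable_id : q.-integrable setT (fun x : measurableTypeR R => x%:E).
Proof.
have int1 : q.-integrable setT
    (EFin \o (fun x : measurableTypeR R => (x - mean q) ^+ 2 + (1 + `|mean q|))).
  apply: (integrable_EFinD integrable_sq0).
  exact: integrable_cst_prob.
apply: le_integrable int1 => //; first exact/measurable_EFinP.
move=> x _ /=; rewrite !lee_fin.
have h1 : 0 <= (x - mean q) ^+ 2 by exact: sqr_ge0.
rewrite [leRHS]ger0_norm ?addr_ge0//.
have -> : x = (x - mean q) + mean q by ring.
apply: (le_trans (ler_normD _ _)).
rewrite addrA lerD2r addrK -[X in _ <= X + _]real_normK ?num_real//.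
set y := `|_|; nra.
Qed.

Lemma mean_Rintegral : mean q = \int[q]_x x.
Proof. by rewrite /mean expectation.unlock. Qed.

Lemma integrable_sqr c :
  q.-integrable setT (fun x : measurableTypeR R => ((x - c) ^+ 2)%:E).
Proof.
have -> : (fun x : measurableTypeR R => ((x - c) ^+ 2)%:E) =
   EFin \o (fun x => (x - mean q) ^+ 2 + (2 * (mean q - c) * x +
     (c ^+ 2 - mean q ^+ 2))).
  by apply/funext => x /=; congr EFin; ring.
apply: (integrable_EFinD integrable_sq0).
apply: integrable_EFinD => //; first exact: integrable_EFinZ integrable_id.
exact: integrable_cst_prob.
Qed.

Lemma Rintegral_sqr c : \int[q]_x (x - c) ^+ 2 <= V + (mean q - c) ^+ 2.
Proof.
have iid := integrable_id; have isq := integrable_sqr (mean q).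
have icst k : q.-integrable setT (EFin \o (fun=> k : R)).
  exact: integrable_cst_prob.
rewrite (@eq_Rintegral _ _ _ q setT (fun x => (x - mean q) ^+ 2 +
    (2 * (mean q - c) * x + (c ^+ 2 - mean q ^+ 2)))); last first.
  by move=> x _ /=; ring.
have iZ : q.-integrable setT
    (EFin \o (fun x : measurableTypeR R => 2 * (mean q - c) * x)).
  exact: integrable_EFinZ iid.
rewrite RintegralD//; last by apply: integrable_EFinD.
rewrite RintegralD// RintegralZl// -mean_Rintegral Rintegral_cst_prob.
have : \int[q]_x (x - mean q) ^+ 2 <= V.
  by rewrite -lee_fin fineK//; exact: integrable_fin_num.
by nra.
Qed.

End mean_variance.

(** Multiply [exp (h y) (1 - h y) <= 1] by [y] when [y >= 0], and [1 + h y <= exp (h y)] by [- y]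
    when [y < 0]; each sign needs only one of the two squares on the right. *)
Lemma tilt_pointwise (R : realType) (h y : R) : 0 < h ->
  y * expR (h * y) - y <= h * (y ^+ 2 * expR (h * y) + y ^+ 2).
Proof.
move=> h0.
have e0 : 0 < expR (h * y) by exact: expR_gt0.
have e1 : 1 + h * y <= expR (h * y) by exact: expR_ge1Dx.
have e2 : 1 - h * y <= expR (- (h * y)) by exact: expR_ge1Dx.
have e3 : expR (h * y) * (1 - h * y) <= 1.
  by rewrite -[leRHS](expRxMexpNx_1 (h * y)) ler_pM2l.
have y2 : 0 <= h * y ^+ 2 by rewrite mulr_ge0 ?sqr_ge0 ?ltW.
have [y0|y0] := leP 0 y.
  suff : y * (expR (h * y) * (1 - h * y)) <= y * 1 by nra.
  exact: ler_wpM2l.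
suff : - y * (1 + h * y) <= - y * expR (h * y) by nra.
by apply: ler_wpM2l => //; lra.
Qed.

Section tilting.
Context (R : realType) (p q : probability (measurableTypeR R) R) (h k V : R).
Hypothesis qE : forall A, measurable A ->
  q A = (\int[p]_(x in A) (expR (h * x - k))%:E)%E.
Hypothesis varp : ('V_p[(fun x => x)] <= V%:E)%E.
Hypothesis varq : ('V_q[(fun x => x)] <= V%:E)%E.

Let mexp : measurable_fun setT (fun x : measurableTypeR R => expR (h * x - k)).
Proof.
by apply: measurableT_comp => //; apply: measurable_funB => //; exact: measurable_funM.
Qed.

Let g0 (x : measurableTypeR R) : 0 <= expR (h * x - k).
Proof. exact: expR_ge0. Qed.

Let integrable_tilt (f : measurableTypeR R -> R) :
  q.-integrable setT (EFin \o f) ->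
  p.-integrable setT (EFin \o (fun x => f x * expR (h * x - k))).
Proof. exact: (integrable_density g0 mexp qE). Qed.

Let mid : measurable_fun setT (fun x : measurableTypeR R => x).
Proof. by []. Qed.

Let icst r : p.-integrable setT (EFin \o (fun=> r : R)).
Proof. exact: integrable_cst_prob. Qed.

Let iZ r : p.-integrable setT (EFin \o (fun x : measurableTypeR R => r * x)).
Proof. exact/integrable_EFinZ/(integrable_id varp). Qed.

Lemma tilt_norm : \int[p]_x expR (h * x - k) = 1.
Proof. by rewrite /Rintegral -qE// probability_setT. Qed.

Lemma integrable_expR : p.-integrable setT (EFin \o (fun x => expR (h * x - k))).
Proof.
apply/integrableP; split; first exact/measurable_EFinP.
under eq_integral do rewrite gee0_abs ?lee_fin//.
by rewrite -qE// probability_setT ltry.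
Qed.

(** Integrate [1 + u <= exp u]. With [h = s - t] and [k = b s - b t] this is the tangent inequality
    for the log-partition function. *)
Lemma tilt_convex : h * mean p <= k.
Proof.
have : \int[p]_x (h * x + (1 - k)) <= \int[p]_x expR (h * x - k).
  apply: le_Rintegral => //; [exact: integrable_EFinD|exact: integrable_expR|].
  by move=> x _; apply: le_trans (expR_ge1Dx _); lra.
rewrite tilt_norm RintegralD// RintegralZl//; last exact: integrable_id varp.
rewrite -mean_Rintegral Rintegral_cst_prob; lra.
Qed.

(** The choice [k = h * c] makes the density [exp (h (x - c))], so the difference of means is the
    [p]-integral of [(x - c) (exp (h (x - c)) - 1)]. [tilt_pointwise] bounds it by [h] times the sum
    of both second moments around [c]. *)
Lemma tilt_mean_step c : 0 < h -> k = h * c ->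
  mean q - mean p <= h * (V + (mean q - c) ^+ 2 + (V + (mean p - c) ^+ 2)).
Proof.
move=> h0 kE.
have mB : measurable_fun setT (fun x : measurableTypeR R => x - c).
  exact: measurable_funB.
have ipid := integrable_id varp; have iqid := integrable_id varq.
have ip1 : p.-integrable setT (EFin \o (fun x : measurableTypeR R => x - c)).
  apply: integrable_EFinB => //; exact: icst.
have iq1 : q.-integrable setT (EFin \o (fun x : measurableTypeR R => x - c)).
  by apply: integrable_EFinB => //; exact: integrable_cst_prob.
have ip2 := integrable_sqr varp c; have iq2 := integrable_sqr varq c.
have -> : mean q - mean p = \int[q]_x (x - c) - \int[p]_x (x - c).
  rewrite !RintegralB//; last exact: integrable_cst_prob.
  by rewrite !Rintegral_cst_prob -!mean_Rintegral; ring.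
apply: le_trans (_ : h * (\int[q]_x (x - c) ^+ 2 + \int[p]_x (x - c) ^+ 2) <= _);
  last by rewrite ler_pM2l// lerD//; exact: Rintegral_sqr.
rewrite !(Rintegral_density g0 mexp qE)//; last exact: measurable_funX.
rewrite -RintegralB//; last exact: integrable_tilt iq1.
rewrite -RintegralD//; last exact: integrable_tilt iq2.
rewrite -RintegralZl//; last by apply: integrable_EFinD => //; exact: integrable_tilt iq2.
apply: le_Rintegral => //.
- by apply: integrable_EFinB => //; exact: integrable_tilt iq1.
- by apply: integrable_EFinZ => //; apply: integrable_EFinD => //; exact: integrable_tilt iq2.
- move=> x _; have -> : h * x - k = h * (x - c) by rewrite kE; ring.
  exact: tilt_pointwise.
Qed.

End tilting.

Lemma lipschitz_IVT (R : realType) (f : R -> R) (a b L y : R) : a <= b ->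
  (forall u v, a <= u -> u <= v -> v <= b -> `|f v - f u| <= L * (v - u)) ->
  (f a <= y <= f b) || (f b <= y <= f a) ->
  exists2 c, a <= c <= b & f c = y.
Proof.
move=> ab lipf yab.
have lipf' u v : u \in `[a, b] -> v \in `[a, b] -> `|f u - f v| <= `|L| * `|u - v|.
  rewrite !in_itv /= => /andP[au ub] /andP[av vb].
  have [uv|vu] := leP u v.
    rewrite distrC (le_trans (lipf _ _ au uv vb))// (distrC u).
    by rewrite (ger0_norm (x := v - u)) ?subr_ge0// ler_wpM2r ?subr_ge0// ler_norm.
  have {}vu := ltW vu; rewrite (le_trans (lipf _ _ av vu ub))//.
  by rewrite (ger0_norm (x := u - v)) ?subr_ge0// ler_wpM2r ?subr_ge0// ler_norm.
have cf : {within `[a, b], continuous f}.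
  apply/subspace_continuousP => x xab; apply/cvgrPdist_lt => e e0.
  (* [L] may vanish or be negative, hence [|L| + 1] in the modulus of continuity. *)
  have L1 : 0 < `|L| + 1 by rewrite ltr_wpDl.
  rewrite near_withinE; near=> z => zab.
  apply: (le_lt_trans (lipf' _ _ xab zab)).
  apply: (@le_lt_trans _ _ ((`|L| + 1) * `|x - z|)).
    by rewrite ler_wpM2r// lerDl.
  rewrite -ltr_pdivlMl// mulrC.
  near: z; apply: (@nbhsx_ballx _ _ x (e / (`|L| + 1)));  exact: divr_gt0.
have [|c cab fc] := @IVT R f a b y ab cf.
  case/orP: yab => /andP[y1 y2].
    by rewrite ge_min y1 le_max y2 orbT.
  by rewrite ge_min y1 le_max y2 !orbT.
by exists c => //; move: cab; rewrite in_itv.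
Unshelve. all: by end_near.
Qed.

(** * Exponential families *)

Section convex_potential.
Context (R : realType) (Theta : set R) (V : R) (b M : R -> R).
Hypothesis itvTheta : is_interval Theta.
Hypothesis V0 : 0 <= V.
Hypothesis convexb : forall t s, Theta t -> Theta s -> b t + M t * (s - t) <= b s.
Hypothesis stepM : forall u s c, Theta u -> Theta s -> u < s ->
  b s - b u = (s - u) * c ->
  M s - M u <= (s - u) * (V + (M s - c) ^+ 2 + (V + (M u - c) ^+ 2)).

Lemma grad_mono t s : Theta t -> Theta s -> t <= s -> M t <= M s.
Proof.
move=> Tt Ts; rewrite le_eqVlt => /predU1P[->//|ts].
have h1 := convexb Tt Ts; have h2 := convexb Ts Tt.
have : 0 <= (M s - M t) * (s - t) by lra.
by rewrite pmulr_lge0 ?subr_gt0// subr_ge0.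
Qed.

(** The slope [c] lies between [M u] and [M s], so the quadratic term of [stepM] is at most
    [(s - u) (M s - M u)^2]. On a short step this is at most a quarter of [M s - M u], which the
    left side absorbs. *)
Let grad_lip_step u s : Theta u -> Theta s -> u < s ->
  (s - u) * (M s - M u) <= 4^-1 -> M s - M u <= 4 * V * (s - u).
Proof.
move=> Tu Ts us small.
have h0 : 0 < s - u by rewrite subr_gt0.
pose c := (b s - b u) / (s - u).
have := stepM Tu Ts us (c := c).
rewrite mulrC divfK ?gt_eqF// => /(_ erefl).
have c1 : M u <= c.
  by rewrite ler_pdivlMr// lerBrDl convexb.
have c2 : c <= M s.
  by rewrite ler_pdivrMr//; have := convexb Ts Tu; lra.
have d0 : 0 <= M s - M u by have := grad_mono Tu Ts (ltW us); lra.
have sq : (M s - c) ^+ 2 + (M u - c) ^+ 2 <= (M s - M u) ^+ 2 by nra.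
move=> H.
have : (s - u) * (M s - M u) ^+ 2 <= 4^-1 * (M s - M u).
  by rewrite expr2 mulrA ler_wpM2r.
have : (s - u) * ((M s - c) ^+ 2 + (M u - c) ^+ 2) <= (s - u) * (M s - M u) ^+ 2.
  by rewrite ler_pM2l.
have : 0 <= V * (s - u) by rewrite mulr_ge0// ltW.
nra.
Qed.

Lemma grad_lip u s : Theta u -> Theta s -> u <= s ->
  M s - M u <= 4 * V * (s - u).
Proof.
move=> Tu Ts; rewrite le_eqVlt => /predU1P[->|us]; first by rewrite !subrr mulr0.
have d0 : 0 <= M s - M u by rewrite subr_ge0 grad_mono// ltW.
have su0 : 0 < s - u by rewrite subr_gt0.
(* Subdivide [[u, s]] finely enough for the quadratic term to be absorbed. *)
pose x := 4 * ((s - u) * (M s - M u)).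
have x0 : 0 <= x by rewrite !mulr_ge0// ltW.
have [n xn] : exists n, x < n.+1%:R by exists (Num.truncn x); rewrite truncnS_gt.
move: n.+1 xn (ltn0Sn n) => {}n xn n_gt0.
have n0 : 0 < n%:R :> R by rewrite ltr0n.
have nn0 : n%:R != 0 :> R by rewrite gt_eqF.
pose h := (s - u) / n%:R.
have h0 : 0 < h by rewrite divr_gt0.
have hn : h * n%:R = s - u by rewrite divfK.
have tI i : (i <= n)%N -> u <= u + h * i%:R <= s.
  move=> ni; rewrite lerDl mulr_ge0 ?(ltW h0)//=.
  by rewrite -lerBrDl -hn ler_pM2l// ler_nat.
have tT i : (i <= n)%N -> Theta (u + h * i%:R).
  by move=> /tI; exact: itvTheta.
suff H i : (i <= n)%N -> M (u + h * i%:R) - M u <= 4 * V * (h * i%:R).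
  by have := H n (leqnn n); rewrite hn subrKC.
elim: i => [|i IH] ni; first by rewrite !mulr0 addr0 subrr.
have {}IH := IH (ltnW ni).
have ht : u + h * i.+1%:R - (u + h * i%:R) = h by rewrite -natr1; ring.
have lt : u + h * i%:R < u + h * i.+1%:R by rewrite -subr_gt0 ht.
have := grad_lip_step (tT _ (ltnW ni)) (tT _ ni) lt.
rewrite ht => /(_ _).
have le1 : M u <= M (u + h * i%:R).
  by apply: grad_mono => //; [exact/tT/ltnW|have /andP[] := tI i (ltnW ni)].
have le2 : M (u + h * i.+1%:R) <= M s.
  by apply: grad_mono => //; [exact/tT|have /andP[] := tI _ ni].
have hs : h * (M (u + h * i.+1%:R) - M (u + h * i%:R)) <= 4^-1.
  apply: le_trans (_ : h * (M s - M u) <= _).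
    by rewrite ler_pM2l//; lra.
  rewrite -(ler_pM2r n0) mulrAC hn.
  have := ltW xn; rewrite /x; lra.
move=> /(_ hs); rewrite -natr1; lra.
Qed.

(** The tangent is taken at the first argument, to match the order of arguments in [KL]. *)
Definition bregman t s : R := b s - b t - M t * (s - t).

Lemma bregmanE t s : bregman t s = (t - s) * M t - (b t - b s).
Proof. by rewrite /bregman; ring. Qed.

Lemma bregman_refl t : bregman t t = 0.
Proof. by rewrite /bregman !subrr mulr0 subrr. Qed.

Lemma bregman_ge0 t s : Theta t -> Theta s -> 0 <= bregman t s.
Proof. by move=> Tt Ts; have := convexb Tt Ts; rewrite /bregman; lra. Qed.

(** The two sides differ by [(M s - M t) (v - s)], which is nonnegative when [s] lies between [t]
    and [v] because [M] is monotone. *)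
Lemma bregman_three t s v : Theta t -> Theta s -> Theta v ->
  0 <= (s - t) * (v - s) -> bregman t s + bregman s v <= bregman t v.
Proof.
move=> Tt Ts Tv tsv; rewrite /bregman.
suff : 0 <= (M s - M t) * (v - s) by lra.
have [ts|st|tsE] := ltgtP t s; last by rewrite tsE subrr mul0r.
- have vs : 0 <= v - s by move: tsv; rewrite pmulr_rge0// subr_gt0.
  by rewrite mulr_ge0// subr_ge0 grad_mono// ltW.
- have vs : v - s <= 0 by move: tsv; rewrite nmulr_rge0// subr_lt0.
  by rewrite mulr_le0// subr_le0 grad_mono// ltW.
Qed.

(* Convexity of [b] at the intermediate point [s - x], where [x] maximizes
   [x (delta - 4 V x)] for [delta = M s - M t]. *)
Lemma bregman_lower t s : Theta t -> Theta s ->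
  (M t - M s) ^+ 2 <= 16 * V * bregman t s.
Proof.
move=> Tt Ts.
(* The witness below divides by [V]; when [V = 0] the Lipschitz bound makes [M] constant. *)
have [V_eq0|V_neq0] := eqVneq V 0.
  rewrite V_eq0 mulr0 mul0r; suff -> : M t = M s by rewrite subrr expr0n.
  apply/eqP; rewrite eq_le.
  have [ts|st] := leP t s.
    by rewrite grad_mono//=; have := grad_lip Tt Ts ts; nra.
  rewrite (grad_mono Ts Tt (ltW st))// andbT.
  by have := grad_lip Ts Tt (ltW st); nra.
have {V_neq0}V_gt0 : 0 < V by rewrite lt_neqAle eq_sym V_neq0.
have V8 : 0 < 8 * V by rewrite mulr_gt0.
have [ts|/ltW st] := leP t s.
- have d0 : 0 <= M s - M t by rewrite subr_ge0 grad_mono.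
  pose x := (M s - M t) / (8 * V).
  have x0 : 0 <= x by rewrite divr_ge0// ltW.
  have xE : x * (8 * V) = M s - M t by rewrite divfK ?gt_eqF.
  have xst : x <= s - t.
    by rewrite ler_pdivrMr//; have := grad_lip Tt Ts ts; nra.
  have Tv : Theta (s - x) by apply: (itvTheta Tt Ts); lra.
  have := convexb Tv Ts; have := convexb Tt Tv.
  have : s - x <= s by lra.
  move/(grad_lip Tv Ts); rewrite /bregman; nra.
- have d0 : 0 <= M t - M s by rewrite subr_ge0 grad_mono.
  pose x := (M t - M s) / (8 * V).
  have x0 : 0 <= x by rewrite divr_ge0// ltW.
  have xE : x * (8 * V) = M t - M s by rewrite divfK ?gt_eqF.
  have xst : x <= t - s.
    by rewrite ler_pdivrMr//; have := grad_lip Ts Tt st; nra.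
  have Tv : Theta (s + x) by apply: (itvTheta Ts Tt); lra.
  have := convexb Tv Ts; have := convexb Tt Tv.
  have : s <= s + x by lra.
  move/(grad_lip Ts Tv); rewrite /bregman; nra.
Qed.

Lemma grad_ivt t s y : Theta t -> Theta s -> t <= s ->
  M t <= y <= M s -> exists2 v, t <= v <= s & M v = y.
Proof.
move=> Tt Ts ts yts; apply: (@lipschitz_IVT _ _ _ _ (4 * V)) => //.
  move=> u v tu uv vs; have Tu : Theta u by apply: (itvTheta Tt Ts); lra.
  have Tv : Theta v by apply: (itvTheta Tt Ts); lra.
  rewrite ler_norml; have := grad_lip Tu Tv uv.
  have := grad_mono Tu Tv uv; lra.
by rewrite yts.
Qed.

(** As its first argument moves from [t] to [s], the divergence to [s] goes down to 0, and it is
    Lipschitz: its change between [u] and [v] is at most [|M v - M u|] times a distance bounded by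
    [|s - t|]. *)
Lemma bregman_ivt t s y : Theta t -> Theta s -> 0 <= y <= bregman t s ->
  exists2 v, Num.min t s <= v <= Num.max t s & bregman v s = y.
Proof.
move=> Tt Ts /andP[y0 yts].
have bregss : bregman s s = 0 by rewrite /bregman !subrr mulr0 subrr.
pose L := 4 * V * `|s - t|.
have bregB u v : Theta u -> Theta v ->
  bregman u s - bregman v s = bregman u v + (M v - M u) * (s - v) by rewrite /bregman => _ _; ring.
have bregM u v : Theta u -> Theta v -> bregman u v <= (M v - M u) * (v - u).
  by move=> Tu Tv; have := convexb Tv Tu; rewrite /bregman; lra.
have [ts|/ltW st] := leP t s.
- apply: (@lipschitz_IVT _ _ _ _ L) => //; last by rewrite bregss y0 yts orbT.
  move=> u v tu uv vs; have Tu : Theta u by apply: (itvTheta Tt Ts); lra.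
  have Tv : Theta v by apply: (itvTheta Tt Ts); lra.
  have Muv := grad_lip Tu Tv uv; have Mm := grad_mono Tu Tv uv.
  rewrite distrC bregB// /L [`|s - t|]ger0_norm ?subr_ge0// ger0_norm; last first.
    by rewrite addr_ge0 ?bregman_ge0// mulr_ge0; lra.
  have := bregM _ _ Tu Tv.
  have : (M v - M u) * (s - u) <= 4 * V * (v - u) * (s - t).
    by apply: ler_pM; lra.
  lra.
- apply: (@lipschitz_IVT _ _ _ _ L) => //; last by rewrite bregss y0 yts.
  move=> u v su uv vt; have Tu : Theta u by apply: (itvTheta Ts Tt); lra.
  have Tv : Theta v by apply: (itvTheta Ts Tt); lra.
  have Muv := grad_lip Tu Tv uv; have Mm := grad_mono Tu Tv uv.
  rewrite bregB// /L [`|s - t|]ler0_norm ?subr_le0// ger0_norm; last first.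
    by rewrite addr_ge0 ?bregman_ge0// mulr_le0; lra.
  have := bregM _ _ Tv Tu.
  have : (M v - M u) * (v - s) <= 4 * V * (v - u) * (t - s).
    by apply: ler_pM; lra.
  lra.
Qed.

(** Equal slopes force the two tangents to coincide, so the divergence sees its first argument only
    through the gradient. *)
Lemma bregman_same_grad t t' s : Theta t -> Theta t' -> M t = M t' ->
  bregman t s = bregman t' s.
Proof.
move=> Tt Tt' MM; have := convexb Tt Tt'.
have := convexb Tt' Tt; rewrite /bregman MM; lra.
Qed.

Lemma grad_lt t s : Theta t -> Theta s -> M t < M s -> t < s.
Proof. by move=> Tt Ts; apply: contraTT; rewrite -!leNgt; exact: grad_mono. Qed.

End convex_potential.

Lemma density_probability d (X : measurableType d) (R : realType)
    (mu : {measure set X -> \bar R}) (g : X -> R) :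
  (forall x, 0 <= g x) -> measurable_fun setT g ->
  (\int[mu]_x (g x)%:E = 1)%E ->
  exists q : probability X R,
    forall A, measurable A -> q A = (\int[mu]_(x in A) (g x)%:E)%E.
Proof.
move=> g0 mg g1; pose f A := (\int[mu]_(x in A) (g x)%:E)%E.
have f0 : f set0 = 0%E by rewrite /f integral_set0.
have fge0 A : (0 <= f A)%E by apply: integral_ge0 => x _; rewrite lee_fin.
have fsig : semi_sigma_additive f.
  move=> /= F mF tF mUF; rewrite /f ge0_integral_bigcup//.
  - apply: is_cvg_ereal_nneg_natsum_cond => n _ _.
    by apply: integral_ge0 => x _; rewrite lee_fin.
  - exact/measurable_EFinP/measurable_funTS.
  - by move=> x _; rewrite lee_fin.
pose M := HB.pack_for {measure set X -> \bar R} f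
  (isMeasure.Build _ _ _ f f0 fge0 fsig).
pose Q := HB.pack_for (probability X R) (Measure.sort M)
  (Measure_isProbability.Build _ _ _ M g1).
by exists Q.
Qed.

Lemma tilt_arg (R : comPzRingType) (x s t bs bt : R) :
  (s - t) * x - (bs - bt) + (x * t - bt) = x * s - bs.
Proof. ring. Qed.

(** * Members of the family, their means and divergences *)

Section exponential_family.
Local Open Scope charge_scope.
Context (R : realType) (m : {measure set (measurableTypeR R) -> \bar R})
  (Theta : set R) (V : R).
Hypothesis itvTheta : is_interval Theta.
Hypothesis Z_gt0_lty :
  forall theta, Theta theta -> (0 < partition_fun m theta < +oo)%E.
Hypothesis varV :
  forall q, exp_family m Theta q -> ('V_q[(fun x => x)] <= V%:E)%E.

Local Notation b := (log_partition m).
Local Notation T := (measurableTypeR R).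

(** Membership in [exp_family] with the parameter made explicit. *)
Definition tilted (q : probability T R) (t : R) := forall A, measurable A ->
  q A = (\int[m]_(x in A) (expR (x * t - b t))%:E)%E.

Let mexp t : measurable_fun setT (fun x : T => expR (x * t - b t)).
Proof. by apply: measurableT_comp => //; apply: measurable_funB => //; exact: measurable_funM. Qed.

Let exp0 t (x : T) : 0 <= expR (x * t - b t).
Proof. exact: expR_ge0. Qed.

Lemma exists_tilted t : Theta t -> exists q, tilted q t.
Proof.
move=> Tt; apply: density_probability => //.
have /andP[Z0 Zoo] := Z_gt0_lty Tt.
have Zp : 0 < fine (partition_fun m t) by apply: fine_gt0; rewrite Z0.
have Zfin : partition_fun m t \is a fin_num by rewrite ge0_fin_numE ?ltW.
(* Positivity and finiteness of the partition function keep [fine] and [ln] away from their default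
   values. *)
have ebt : expR (- b t) = (fine (partition_fun m t))^-1.
  by rewrite expRN lnK.
under eq_integral do rewrite expRD ebt mulrC EFinM.
rewrite ge0_integralZl//; last first.
- by rewrite lee_fin invr_ge0; exact: ltW.
- by apply/measurable_EFinP; apply: measurableT_comp => //; exact: measurable_funM.
- rewrite -/(partition_fun m t) -(fineK Zfin) -EFinM mulVf//.
  by rewrite gt_eqF.
Qed.

(** Puts two members in the setting of section [tilting], with [h = s - t] and [k = b s - b t]. *)
Lemma tilted_density q p s t : tilted q s -> tilted p t ->
  forall A, measurable A ->
  q A = (\int[p]_(x in A) (expR ((s - t) * x - (b s - b t)))%:E)%E.
Proof.
move=> qs pt A mA; rewrite qs// integral_mkcond [RHS]integral_mkcond.
have mg : measurable_fun setT (fun x : T => expR ((s - t) * x - (b s - b t))).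
  by apply: measurableT_comp => //; apply: measurable_funB => //; exact: measurable_funM.
rewrite (ge0_integral_density (exp0 t) (mexp t) pt); last 2 first.
- by apply: erestrict_ge0 => x _; rewrite lee_fin expR_ge0.
- apply: (measurable_restrictT _ mA).1; apply: measurable_funTS.
  exact/measurable_EFinP.
apply: eq_integral => x _; rewrite /patch; case: ifP => _; last by rewrite mul0e.
by rewrite -EFinM -expRD; rewrite tilt_arg.
Qed.

Definition tilt_mean t : R := \int[m]_x (x * expR (x * t - b t)).
Local Notation M := tilt_mean.

Lemma mean_tilted q t : tilted q t -> mean q = M t.
Proof.
move=> qt; rewrite mean_Rintegral.
exact: (Rintegral_density (exp0 t) (mexp t) qt).
Qed.

Lemma variance_tilted q t : Theta t -> tilted q t ->
  ('V_q[(fun x => x)] <= V%:E)%E.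
Proof.
by move=> Tt qt; apply: varV; exists t; [exact Tt|exact qt].
Qed.

Lemma log_partition_convex t s : Theta t -> Theta s ->
  b t + M t * (s - t) <= b s.
Proof.
move=> Tt Ts; have [p pt] := exists_tilted Tt; have [q qs] := exists_tilted Ts.
have := tilt_convex (tilted_density qs pt) (variance_tilted Tt pt).
by rewrite (mean_tilted pt) -lerBrDl mulrC.
Qed.

Lemma variance_bound_ge0 t : Theta t -> 0 <= V.
Proof.
move=> Tt; have [p pt] := exists_tilted Tt.
by rewrite -lee_fin (le_trans (variance_ge0 _ _) (variance_tilted Tt pt)).
Qed.

Lemma log_partition_step u s c : Theta u -> Theta s -> u < s ->
  b s - b u = (s - u) * c ->
  M s - M u <= (s - u) * (V + (M s - c) ^+ 2 + (V + (M u - c) ^+ 2)).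
Proof.
move=> Tu Ts us kE; rewrite -subr_gt0 in us.
have [p pu] := exists_tilted Tu; have [q qs] := exists_tilted Ts.
have := tilt_mean_step (tilted_density qs pu) (variance_tilted Tu pu)
  (variance_tilted Ts qs) us kE.
by rewrite (mean_tilted pu) (mean_tilted qs).
Qed.

Lemma tilt_mean_mono t s : Theta t -> Theta s -> t <= s -> M t <= M s.
Proof. exact: (grad_mono log_partition_convex). Qed.

Lemma tilt_mean_lt t s : Theta t -> Theta s -> M t < M s -> t < s.
Proof. exact: (grad_lt log_partition_convex). Qed.

Lemma tilt_mean_ivt t s y : Theta t -> Theta s -> t <= s ->
  M t <= y <= M s -> exists2 v, t <= v <= s & M v = y.
Proof.
move=> Tt; exact: (grad_ivt itvTheta (variance_bound_ge0 Tt)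
  log_partition_convex log_partition_step Tt).
Qed.

Local Notation kl := (bregman b M).

Lemma kl_ge0 t s : Theta t -> Theta s -> 0 <= kl t s.
Proof. exact: (bregman_ge0 log_partition_convex). Qed.

Lemma kl_three t s v : Theta t -> Theta s -> Theta v ->
  0 <= (s - t) * (v - s) -> kl t s + kl s v <= kl t v.
Proof. exact: (bregman_three log_partition_convex). Qed.

Lemma kl_lower t s : Theta t -> Theta s -> (M t - M s) ^+ 2 <= 16 * V * kl t s.
Proof.
move=> Tt; exact: (bregman_lower itvTheta (variance_bound_ge0 Tt)
  log_partition_convex log_partition_step Tt).
Qed.

Lemma kl_ivt t s y : Theta t -> Theta s -> 0 <= y <= kl t s ->
  exists2 v, Num.min t s <= v <= Num.max t s & kl v s = y.
Proof.
move=> Tt; exact: (bregman_ivt itvTheta (variance_bound_ge0 Tt)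
  log_partition_convex log_partition_step Tt).
Qed.

Lemma kl_same_mean t t' s : Theta t -> Theta t' -> M t = M t' ->
  kl t s = kl t' s.
Proof. exact: (bregman_same_grad log_partition_convex). Qed.

Lemma mgf_tilted q t s : tilted q t -> Theta t -> Theta s ->
  (\int[q]_x (expR ((s - t) * x - (b s - b t)))%:E = 1)%E.
Proof.
move=> qt Tt Ts; have [p ps] := exists_tilted Ts.
by rewrite -(tilted_density ps qt)// probability_setT.
Qed.

(** The Radon-Nikodym derivative agrees with the explicit exponential density [q]-almost everywhere,
    hence [p]-almost everywhere by domination. Its logarithm is affine, and integrates under [p] to
    the Bregman divergence. *)
Lemma KL_div_tilted p q t s : Theta t -> Theta s -> tilted p t -> tilted q s ->
  KL_div p q = (kl t s)%:E.
Proof.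
move=> Tt Ts pt qs.
have varp := variance_tilted Tt pt.
have pE := tilted_density pt qs; set g := fun x : T => (t - s) * x - (b t - b s).
have mg : measurable_fun setT g.
  by apply: measurable_funB => //; exact: measurable_funM.
have mexpg : measurable_fun setT (fun x : T => (expR (g x))%:E).
  by apply/measurable_EFinP; exact: measurableT_comp.
have pq : p `<< q.
  apply/null_content_dominatesP => A mA qA0; rewrite pE//.
  apply: null_set_integral => //.
  exact: measurable_funTS.
have RN : ae_eq q setT ('d (charge_of_finite_measure p) '/d q)
    (fun x => (expR (g x))%:E).
  apply: integral_ae_eq => //; first exact: Radon_Nikodym_integrable.
  by move=> E _ mE; rewrite -Radon_Nikodym_integral//= -pE.
have RNp : ae_eq p setT ('d (charge_of_finite_measure p) '/d q)
    (fun x => (expR (g x))%:E).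
  exact: null_dominates_ae_eq pq RN.
rewrite /KL_div (ae_eq_integral (fun x => (g x)%:E))//.
- have p1 := integrable_id varp.
  have -> : kl t s = \int[p]_x g x.
    rewrite RintegralB//; last 2 first.
    + exact: integrable_EFinZ p1.
    + exact: integrable_cst_prob.
    by rewrite RintegralZl// Rintegral_cst_prob bregmanE -mean_Rintegral (mean_tilted pt).
  rewrite /Rintegral fineK//; apply: integrable_fin_num => //.
  apply: (integrable_EFinB (integrable_EFinZ (t - s) p1)).
  exact: integrable_cst_prob.
- have RNfin x : ('d (charge_of_finite_measure p) '/d q) x \is a fin_num.
    exact: Radon_Nikodym_fin_num.
  have mRN : measurable_fun setT ('d (charge_of_finite_measure p) '/d q).
    exact/measurable_int/Radon_Nikodym_integrable.
  have mf : measurable_fun setT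
    (fun x => fine (('d (charge_of_finite_measure p) '/d q) x)).
    exact: measurableT_comp.
  (* Measurability: since the derivative is finite everywhere, [lne] is a case distinction between
     [-oo] and a real logarithm. *)
  have -> : (fun x => lne (('d (charge_of_finite_measure p) '/d q) x)) =
     (fun x => if fine (('d (charge_of_finite_measure p) '/d q) x) <= 0 then -oo%E else
       (ln (fine (('d (charge_of_finite_measure p) '/d q) x)))%:E).
    apply/funext => x; rewrite -[in LHS](fineK (RNfin x)).
    by case: leP => ?; [rewrite le0_lneNy|rewrite lne_EFin].
  apply: measurable_fun_ifT => //.
    exact: measurable_fun_ler.
  by apply/measurable_EFinP; apply: measurableT_comp => //; exact: measurable_ln.
- exact/measurable_EFinP.
- have [N [mN N0 sub]] := RNp; exists N; split => // x /= xN; apply: sub => /= RNx.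
  by apply: xN => xT; rewrite RNx// lne_EFin ?expR_gt0// expRK.
Qed.

(** The domain where [KL] is meaningful; elsewhere [member_of_mean] is an arbitrary value of
    [get]. *)
Definition family_mean x := exists2 q, exp_family m Theta q & mean q = x.

Lemma exp_family_tilted q : exp_family m Theta q ->
  exists t, [/\ Theta t, tilted q t & mean q = M t].
Proof. by move=> [t Tt qt]; exists t; split => //; exact: mean_tilted. Qed.

Lemma tilt_mean_family t : Theta t -> family_mean (M t).
Proof.
move=> Tt; have [q qt] := exists_tilted Tt; exists q; first by exists t.
exact: mean_tilted.
Qed.

(** Chooses a parameter for the member that [member_of_mean] selects, which turns every statement on
    [KL] into one on Bregman divergences. *)
Lemma KL_param : exists th : R -> R, forall x, family_mean x ->
  [/\ Theta (th x), M (th x) = x &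
      forall y, family_mean y -> KL m Theta x y = kl (th x) (th y)].
Proof.
have /choice[th thP] : forall x, exists t, family_mean x ->
    [/\ Theta t, tilted (member_of_mean m Theta x) t & x = M t].
  move=> x; have [fx|nfx] := pselect (family_mean x); last by exists 0.
  have [q qm qx] := fx.
  have [Em mx] : [set q | exp_family m Theta q /\ mean q = x]
      (member_of_mean m Theta x).
    by apply: getPex; exists q.
  have [t [Tt tt tM]] := exp_family_tilted Em.
  by exists t => _; split => //; rewrite -tM mx.
exists th => x fx; have [Tx tx xM] := thP _ fx; split => // y fy.
have [Ty ty yM] := thP _ fy.
by rewrite /KL (KL_div_tilted Tx Ty tx ty).
Qed.

Lemma KL_family_ge0 x y : family_mean x -> family_mean y -> 0 <= KL m Theta x y.
Proof.
have [th thP] := KL_param; move=> fx fy.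
have [Tx _ ->//] := thP _ fx; have [Ty _ _] := thP _ fy.
exact: kl_ge0.
Qed.

Lemma KL_family_refl x : family_mean x -> KL m Theta x x = 0.
Proof.
have [th thP] := KL_param; move=> fx; have [Tx _ ->//] := thP _ fx.
exact: bregman_refl.
Qed.

Lemma KL_family_lower x y : family_mean x -> family_mean y ->
  (x - y) ^+ 2 <= 16 * V * KL m Theta x y.
Proof.
have [th thP] := KL_param; move=> fx fy.
have [Tx xM ->//] := thP _ fx; have [Ty yM _] := thP _ fy.
by rewrite -{1}xM -{1}yM; exact: kl_lower.
Qed.

(** Monotonicity in either argument is the three-point inequality with one nonnegative term dropped;
    strictly ordered means have ordered parameters. *)
Lemma KL_family_mono x y z : family_mean x -> family_mean y -> family_mean z ->
  x <= y -> y <= z -> KL m Theta x y <= KL m Theta x z.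
Proof.
move=> fx fy fz; rewrite le_eqVlt => /predU1P[->|xy].
  by move=> _; rewrite KL_family_refl// KL_family_ge0.
rewrite le_eqVlt => /predU1P[->//|yz].
have [th thP] := KL_param.
have [Tx xM KLx] := thP _ fx; have [Ty yM _] := thP _ fy.
have [Tz zM _] := thP _ fz; rewrite !KLx//.
apply: le_trans (kl_three Tx Ty Tz _); first by rewrite lerDl kl_ge0.
by rewrite mulr_ge0// subr_ge0 ltW//; apply: tilt_mean_lt => //;
  rewrite ?xM ?yM ?zM.
Qed.

Lemma KL_family_mono_left x y z : family_mean x -> family_mean y ->
  family_mean z -> x <= y -> y <= z -> KL m Theta y z <= KL m Theta x z.
Proof.
move=> fx fy fz; rewrite le_eqVlt => /predU1P[->//|xy].
rewrite le_eqVlt => /predU1P[->|yz].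
  by rewrite KL_family_refl// KL_family_ge0.
have [th thP] := KL_param.
have [Tx xM KLx] := thP _ fx; have [Ty yM KLy] := thP _ fy.
have [Tz zM _] := thP _ fz; rewrite KLx// KLy//.
apply: le_trans (kl_three Tx Ty Tz _); first by rewrite lerDr kl_ge0.
by rewrite mulr_ge0// subr_ge0 ltW//; apply: tilt_mean_lt => //;
  rewrite ?xM ?yM ?zM.
Qed.

Lemma family_mean_itv : is_interval family_mean.
Proof.
move=> x y fx fy z /andP[]; rewrite le_eqVlt => /predU1P[<-//|xz].
rewrite le_eqVlt => /predU1P[->//|zy].
move: fx fy => [p /exp_family_tilted[t [Tt _ ->]] xM].
move=> [q /exp_family_tilted[s [Ts _ ->]] yM].
have ts : t <= s by apply/ltW/tilt_mean_lt => //; rewrite xM yM (lt_trans xz).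
have [v tvs <-] : exists2 v, t <= v <= s & M v = z.
  by apply: tilt_mean_ivt => //; rewrite xM yM !ltW.
exact/tilt_mean_family/(itvTheta Tt Ts).
Qed.

(** Supplies the end point of the half-line in [level_set]. *)
Lemma KL_family_level x y u : family_mean x -> family_mean y -> x <= y ->
  0 <= u <= KL m Theta x y ->
  exists x', [/\ family_mean x', x' <= y & KL m Theta x' y = u].
Proof.
have [th thP] := KL_param; move=> fx fy xy.
have [Tx xM ->//] := thP _ fx; have [Ty yM _] := thP _ fy.
move=> /(kl_ivt Tx Ty)[v].
move: xy; rewrite le_eqVlt => /predU1P[xy|xy].
  rewrite xy minxx maxxx => /le_anti <- klu; exists y; split => //.
  by have [_ _ ->] := thP _ fy.
have txy : th x < th y by apply: tilt_mean_lt => //; rewrite xM yM.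
rewrite (min_l (ltW txy)) (max_r (ltW txy)) => xvy klu.
have Tv : Theta v by exact: itvTheta xvy.
have fv := tilt_mean_family Tv; exists (M v); split => //.
  by rewrite -[leRHS]yM tilt_mean_mono//; case/andP: xvy.
have [Tv' MMv KLv] := thP _ fv; rewrite (KLv _ fy) -klu.
exact: kl_same_mean Tv' Tv MMv.
Qed.

(* The parameter attaining [y] lies between those of [x] and [q], so that the
   three-point inequality splits the Chernoff rate [l * x - k]. *)
Lemma lower_tilt q x y : exp_family m Theta q ->
  family_mean x -> family_mean y -> x <= y -> y < mean q ->
  exists l k, [/\ l <= 0, (\int[q]_r (expR (l * r - k))%:E = 1)%E &
    (mean q - y) ^+ 2 <= 16 * V * (l * x - k - KL m Theta x y)].
Proof.
move=> /exp_family_tilted[t [Tt qt qM]] fx fy xy yq.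
have [th thP] := KL_param.
have [Tx xM KLx] := thP _ fx; have [Ty yM _] := thP _ fy.
have tyq : th y < t by apply: tilt_mean_lt => //; rewrite yM -qM.
have txy : th x <= th y.
  move: xy; rewrite le_eqVlt => /predU1P[->//|xy].
  by apply/ltW/tilt_mean_lt => //; rewrite xM yM.
exists (th x - t), (b (th x) - b t); split.
- by rewrite subr_le0 (le_trans txy)// ltW.
- exact: mgf_tilted.
- rewrite KLx//; apply: le_trans (_ : _ <= 16 * V * kl (th y) t) _.
    by rewrite qM -[in leLHS]yM -sqrrN opprB; exact: kl_lower.
  rewrite ler_wpM2l ?mulr_ge0 ?(variance_bound_ge0 Tt)//.
  have := bregmanE b M (th x) t; rewrite xM => <-.
  rewrite lerBrDl; apply: kl_three => //.
  by rewrite mulr_ge0 ?subr_ge0// ltW.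
Qed.

(** Tilting [q] to the member of mean [x] makes the Chernoff rate [l * x - k] equal to the
    divergence from that member to [q], which [kl_lower] bounds below. *)
Lemma upper_tilt q x : exp_family m Theta q -> family_mean x -> mean q < x ->
  exists l k, [/\ 0 <= l, (\int[q]_r (expR (l * r - k))%:E = 1)%E &
    (x - mean q) ^+ 2 <= 16 * V * (l * x - k)].
Proof.
move=> /exp_family_tilted[t [Tt qt qM]] fx qx.
have [th thP] := KL_param; have [Tx xM _] := thP _ fx.
have tx : t < th x by apply: tilt_mean_lt => //; rewrite xM -qM.
exists (th x - t), (b (th x) - b t); split.
- by rewrite subr_ge0 ltW.
- exact: mgf_tilted.
- have := bregmanE b M (th x) t; rewrite xM => <-.
  by rewrite qM -[in leLHS]xM; exact: kl_lower.
Qed.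

Lemma variance_bound_gt0 p q : exp_family m Theta p -> exp_family m Theta q ->
  mean p != mean q -> 0 < V.
Proof.
move=> /exp_family_tilted[t [Tt _ ->]] /exp_family_tilted[s [Ts _ ->]] ts.
rewrite lt_neqAle eq_sym (variance_bound_ge0 Tt) andbT.
apply: contra_neq ts => V0; have := kl_lower Tt Ts.
by rewrite V0 mulr0 mul0r => h; apply/eqP; rewrite -subr_eq0 -sqrf_eq0 eq_le h sqr_ge0.
Qed.

End exponential_family.

(** * Ville's inequality for the rewards of an arm *)

Section independent_pair.
Context d1 d2 d3 (X : measurableType d1) (Y : measurableType d2)
  (Z : measurableType d3) (R : realType).
Variables (Q : {finite_measure set X -> \bar R}) (q : probability Z R).
Variables (phi : X -> Y) (psi : X -> Z).
Hypothesis mphi : measurable_fun setT phi.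
Hypothesis mpsi : measurable_fun setT psi.
Hypothesis indep : forall A B, measurable A -> measurable B ->
  (Q (phi @^-1` A `&` psi @^-1` B) = Q (phi @^-1` A) * q B)%E.
Local Open Scope ereal_scope.

(** The joint law of [phi] and [psi] is a product measure, so Tonelli applies. [Q] is a finite
    measure because it will be [P] restricted to the event that a given arm is pulled. *)
Lemma ge0_integral_indep (h : Y -> \bar R) (f : Z -> \bar R) :
  (forall y, 0 <= h y) -> measurable_fun setT h ->
  (forall z, 0 <= f z) -> measurable_fun setT f ->
  \int[Q]_x (h (phi x) * f (psi x)) = \int[Q]_x h (phi x) * \int[q]_z f z.
Proof.
move=> h0 mh f0 mf.
have [m1 m1E] : exists m : {finite_measure set Y -> \bar R},
    forall A, m A = Q (phi @^-1` A).
  pose m : {measure set Y -> \bar R} :=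
    measure_function_pushforward__canonical__measure_function_Measure Q mphi.
  have fm : fin_num_fun m.
    move=> A mA; apply: fin_num_measure.
    by rewrite -[X in measurable X]setTI; exact: mphi.
  pose M := HB.pack_for {finite_measure set Y -> \bar R} (Measure.sort m)
    (Measure_isFinite.Build _ _ _ m fm).
  by exists M.
pose g x := (phi x, psi x).
have mg : measurable_fun setT g by exact: measurable_fun_pair.
pose m2 : {measure set (Y * Z) -> \bar R} :=
  measure_function_pushforward__canonical__measure_function_Measure Q mg.
have m12 : forall C, measurable C -> (m1 \x q) C = m2 C.
  apply: product_measure_unique => A B mA mB.
  transitivity (Q (phi @^-1` A) * q B); first exact: indep.
  by congr (_ * _); exact/esym/m1E.
pose F (z : Y * Z) := h z.1 * f z.2.
have mF : measurable_fun setT F.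
  by apply: emeasurable_funM; apply: measurableT_comp.
have F0 z : 0 <= F z by rewrite mule_ge0.
have -> : \int[Q]_x (h (phi x) * f (psi x)) = \int[m2]_z F z.
  by rewrite (ge0_integral_pushforward mg)//= preimage_setT.
rewrite -(@eq_measure_integral _ _ _ setT m2 (m1 \x q)); last first.
  by move=> C mC _; exact: m12.
rewrite fubini_tonelli1//.
have -> : \int[Q]_x h (phi x) = \int[m1]_y h y.
  transitivity (\int[pushforward Q phi]_y h y).
    by rewrite (ge0_integral_pushforward mphi)//= preimage_setT.
  by apply: eq_measure_integral => A mA _; exact/esym/m1E.
rewrite -ge0_integralZr//; last exact: integral_ge0.
by apply: eq_integral => y _; rewrite /fubini_F /F/= ge0_integralZl.
Qed.

End independent_pair.

(** * The filtration of pulls and rewards *)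

Section history.
Context (R : realType) d (Omega : measurableType d) (P : probability Omega R)
  (K T : nat) (nu : 'I_K -> probability (measurableTypeR R) R)
  (I : nat -> Omega -> 'I_K) (r : nat -> Omega -> R).
Hypothesis inter : bandit_interaction P nu T I r.

(** Naming the generators lets [history] be the measurable sets of a [g_sigma_algebraType], so that
    the usual measurability lemmas apply to past events. *)
Definition history_gen (t : nat) : set (set Omega) :=
  [set A | exists2 i, (1 <= i <= t)%N &
         (exists a : 'I_K, A = I i @^-1` [set a]) \/
         (exists2 B : set (measurableTypeR R),
            measurable B & A = r i @^-1` B)].

Local Notation hType t := (g_sigma_algebraType (history_gen t)).
Local Notation TR := (measurableTypeR R).

Lemma history_mono s t : (s <= t)%N -> history I r s `<=` history I r t.
Proof.
move=> st; apply: sub_sigma_algebra2 => A [i /andP[i1 ist] iA].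
by exists i => //; rewrite i1 (leq_trans ist).
Qed.

Lemma measurable_history t A : (t <= T)%N -> history I r t A -> measurable A.
Proof.
move=> tT; apply: smallest_sub.
  by split => [|B mB|F mF]; [exact: measurable0|rewrite setTD; exact: measurableC|
    exact: bigcupT_measurable].
move=> B [i /andP[i1 it]].
have iT : (1 <= i <= T)%N by rewrite i1 (leq_trans it).
have [mI mr _] := inter iT.
move=> [[a ->]|[C mC ->]]; first exact: mI.
by rewrite -[X in measurable X]setTI; exact: mr.
Qed.

Lemma pull_event_measurable t a : (1 <= t <= T)%N -> measurable (I t @^-1` [set a]).
Proof. by move=> tT; have [mI _ _] := inter tT. Qed.

Lemma history_pull t i a : (1 <= i <= t)%N -> history I r t (I i @^-1` [set a]).
Proof. by move=> it; apply: sub_sigma_algebra; exists i => //; left; exists a. Qed.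

Lemma history_measurable_reward t i : (1 <= i <= t)%N ->
  measurable_fun setT (r i : hType t -> TR).
Proof.
move=> it _ B mB; rewrite setTI; apply: sub_sigma_algebra.
by exists i => //; right; exists B.
Qed.

Lemma measurable_of_history t (f : hType t -> R) : (t <= T)%N ->
  measurable_fun setT f -> measurable_fun [set: Omega] (f : Omega -> R).
Proof.
move=> tT mf _ B mB; rewrite setTI; apply: (measurable_history tT).
by have := mf measurableT B mB; rewrite setTI.
Qed.

(** Under [P] restricted to the pulling of [a], the reward is independent of the identity map into
    the past sigma-algebra. *)
Lemma reward_indep t a (h : hType t.-1 -> \bar R) (f : TR -> \bar R) :
  (1 <= t <= T)%N -> (forall w, 0 <= h w)%E -> measurable_fun setT h ->
  (forall x, 0 <= f x)%E -> measurable_fun setT f ->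
  (\int[P]_(w in I t @^-1` [set a]) (h w * f (r t w)) =
   (\int[P]_(w in I t @^-1` [set a]) h w) * \int[nu a]_x f x)%E.
Proof.
move=> tT h0 mh f0 mf; have [/(_ a) mA mr indep] := inter tT.
have t1T : (t.-1 <= T)%N by case/andP: tT => _; apply: leq_trans; exact: leq_pred.
set A := I t @^-1` [set a] in mA *.
have PAoo : (P A < +oo)%E by rewrite ltey_eq fin_num_measure.
pose Pa : {finite_measure set Omega -> \bar R} := mfrestr mA PAoo.
have PaE (g : Omega -> \bar R) : (forall w, 0 <= g w)%E -> measurable_fun setT g ->
    (\int[P]_(w in A) g w = \int[Pa]_w g w)%E.
  move=> g0 mg; rewrite (@ge0_integral_density _ _ _ P Pa (\1_A))//.
  - rewrite [LHS]integral_mkcond; apply: eq_integral => w _.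
    by rewrite epatch_indic.
  - by move=> B mB; rewrite integral_indic// setIC.
have mid : measurable_fun setT (id : Omega -> hType t.-1).
  by move=> _ B mB; rewrite setTI; exact: measurable_history mB.
have mh' : measurable_fun [set: Omega] (h : Omega -> \bar R).
  by move=> _ B mB; rewrite setTI; apply: (measurable_history t1T);
    have := mh measurableT B mB; rewrite setTI.
rewrite !PaE//; last first.
- by apply: emeasurable_funM => //; exact: measurableT_comp.
- by move=> w; rewrite mule_ge0.
apply: (@ge0_integral_indep _ _ _ Omega (hType t.-1) TR R Pa (nu a) id (r t)) => //.
move=> H B mH mB; rewrite /Pa /= /mfrestr /mrestr.
by have := indep H a B mH mB; rewrite -/A setIAC.
Qed.

End history.

(** * The exponential martingale of an arm *)

Section tilt_process.
Context (R : realType) d (Omega : measurableType d) (P : probability Omega R)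
  (K T : nat) (nu : 'I_K -> probability (measurableTypeR R) R)
  (I : nat -> Omega -> 'I_K) (r : nat -> Omega -> R).
Hypothesis inter : bandit_interaction P nu T I r.
Local Notation hType t := (g_sigma_algebraType (history_gen I r t)).
Local Notation TR := (measurableTypeR R).
Local Notation N := (pull_count I).

Definition cum_reward (t : nat) (a : 'I_K) (w : Omega) : R :=
  \sum_(1 <= i < t.+1 | I i w == a) r i w.
Local Notation S := cum_reward.

Lemma pull_countS t a w : N t.+1 a w = (N t a w + (I t.+1 w == a))%N.
Proof. by rewrite /pull_count big_nat_recr. Qed.

Lemma cum_rewardS t a w :
  S t.+1 a w = S t a w + (if I t.+1 w == a then r t.+1 w else 0).
Proof. by rewrite /cum_reward big_mkcond big_nat_recr// -big_mkcond. Qed.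

Lemma history_measurable_indic t i a : (1 <= i <= t)%N ->
  measurable_fun setT (fun w : hType t => (I i w == a)%:R : R).
Proof.
move=> it; have -> : (fun w : hType t => (I i w == a)%:R : R) =
    \1_(I i @^-1` [set a] : set (hType t)).
  apply/funext => w; rewrite indicE; congr (_%:R).
  by congr nat_of_bool; apply/eqP/idP; rewrite inE.
by apply: measurable_indic; exact: history_pull.
Qed.

Lemma history_measurable_count t a :
  measurable_fun setT (fun w : hType t => (N t a w)%:R : R).
Proof.
under eq_fun do rewrite /pull_count big_add1 big_mkord natr_sum.
apply: measurable_sum => i; apply: history_measurable_indic.
by rewrite ltn_ord.
Qed.

Lemma history_measurable_cum t a : measurable_fun setT (S t a : hType t -> R).
Proof.
rewrite /cum_reward.
under eq_fun do rewrite big_mkcond big_add1 big_mkord.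
apply: measurable_sum => i.
have it : (1 <= i.+1 <= t)%N by rewrite ltn_ord.
rewrite (_ : (fun _ => _) = (fun w => (I i.+1 w == a)%:R * r i.+1 w)).
  by apply: measurable_funM; [exact: history_measurable_indic|exact: history_measurable_reward].
by apply/funext => w; case: eqP; rewrite ?mul1r ?mul0r.
Qed.

Definition tilt_process (a : 'I_K) (l k : R) (t : nat) (w : Omega) : R :=
  expR (l * S t a w - k * (N t a w)%:R).

Section ville.
Variables (a : 'I_K) (l k c : R).
Hypothesis c0 : 0 < c.
Hypothesis mgf1 : (\int[nu a]_x (expR (l * x - k))%:E = 1)%E.
Local Notation W := (tilt_process a l k).

Lemma history_measurable_tilt t : measurable_fun setT (W t : hType t -> R).
Proof.
apply: measurableT_comp => //; apply: measurable_funB; apply: measurable_funM => //.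
  exact: history_measurable_cum.
exact: history_measurable_count.
Qed.

Lemma tilt_processS t w : W t.+1 w =
  W t w * (if I t.+1 w == a then expR (l * r t.+1 w - k) else 1).
Proof.
rewrite /tilt_process pull_countS cum_rewardS natrD.
case: eqP => _; last by rewrite !addr0 mulr1.
by rewrite /= -expRD; congr expR; ring.
Qed.

Lemma measurable_tilt t : (t <= T)%N -> measurable_fun [set: Omega] (W t).
Proof.
by move=> tT; apply: (measurable_of_history inter tT); exact: history_measurable_tilt.
Qed.

(** The process changes only when [a] is pulled, and then by a factor that is independent of the
    past and has integral 1 by [mgf1]. *)
Lemma tilt_process_martingale t H : (t < T)%N -> history I r t H ->
  (\int[P]_(w in H) (W t.+1 w)%:E = \int[P]_(w in H) (W t w)%:E)%E.
Proof.
move=> tT hH; have tT' : (1 <= t.+1 <= T)%N by [].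
have mH := measurable_history inter (ltnW tT) hH.
set A := I t.+1 @^-1` [set a].
have mA : measurable A by exact: (pull_event_measurable inter).
have W0 s w : (0 <= (W s w)%:E)%E by rewrite lee_fin expR_ge0.
have mW s (sT : (s <= T)%N) D : measurable_fun D (fun w => (W s w)%:E).
  have mWs : measurable_fun [set: Omega] (EFin \o W s).
    by apply/measurable_EFinP; exact: measurable_tilt.
  exact: measurable_funTS mWs.
have split s : (s <= T)%N -> (\int[P]_(w in H) (W s w)%:E =
    \int[P]_(w in H `&` A) (W s w)%:E + \int[P]_(w in H `\` A) (W s w)%:E)%E.
  move=> sT; rewrite -ge0_integral_setU//; [|exact: measurableI|exact: measurableD|exact: mW|].
    by rewrite setUIDK.
  by apply/disj_setPS => x [[_ ?] []].
rewrite !split//; last exact: ltnW.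
congr (_ + _)%E; last first.
  apply: eq_integral => w; rewrite inE => -[_ /eqP/negbTE nA].
  by rewrite tilt_processS; move: nA; rewrite /= => ->; rewrite mulr1.
pose h (w : hType t) : \bar R := ((W t w)%:E * (\1_H w)%:E)%E.
have h0 w : (0 <= h w)%E by rewrite mule_ge0// lee_fin.
have mh : measurable_fun setT h.
  apply: emeasurable_funM; first by apply/measurable_EFinP; exact: history_measurable_tilt.
  by apply/measurable_EFinP; apply: measurable_indic.
have hint (g : Omega -> \bar R) :
    (\int[P]_(w in H `&` A) g w = \int[P]_(w in A) (g w * (\1_H w)%:E))%E.
  rewrite integral_mkcondl; apply: eq_integral => w _.
  by rewrite epatch_indic.
have := @reward_indep _ _ _ P K T nu I r inter t.+1 a h
  (fun x => (expR (l * x - k))%:E) tT' h0 mh.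
rewrite mgf1 mule1 !hint => <-.
- apply: eq_integral => w; rewrite inE => wA.
  by rewrite tilt_processS wA eqxx EFinM /h muleAC.
- by move=> x; rewrite lee_fin expR_ge0.
- apply/measurable_EFinP; apply: measurableT_comp => //.
  by apply: measurable_funB => //; exact: measurable_funM.
Qed.

(* The first crossing of level [c] is not introduced explicitly: the martingale
   property is used on the complement of [crossed n]. *)
Definition crossed (n : nat) : set Omega :=
  [set w | exists2 t, (t <= n)%N & c <= W t w].

Lemma history_tilt_ge t : history I r t [set w | c <= W t w].
Proof.
have /(_ measurableT `[c, +oo[%classic (measurable_itv _)) := @history_measurable_tilt t.
rewrite setTI; congr (history I r t _).
by apply/seteqP; split => w /=; rewrite in_itv/= andbT.
Qed.

Lemma crossedS n : crossed n.+1 = crossed n `|` [set w | c <= W n.+1 w].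
Proof.
apply/seteqP; split => w.
  move=> [t]; rewrite leq_eqVlt => /predU1P[->|tn] cW; [by right|].
  by left; exists t.
by move=> [[t tn cW]|cW]; [exists t => //; exact: leqW|exists n.+1].
Qed.

Lemma history_crossed n : history I r n (crossed n).
Proof.
elim: n => [|n IH].
  rewrite (_ : crossed 0 = [set w | c <= W 0 w]); first exact: history_tilt_ge.
  by apply/seteqP; split => w; [move=> [t]; rewrite leqn0 => /eqP ->|exists 0%N].
rewrite crossedS.
apply: (@measurableU _ (hType n.+1)); last exact: history_tilt_ge.
exact: history_mono IH.
Qed.

Lemma tilt_process0 w : W 0 w = 1.
Proof.
rewrite /tilt_process /cum_reward /pull_count !big_geq//.
by rewrite !mulr0 subrr expR0.
Qed.

(** The left side does not increase with [n]: the complement of [crossed n] is a past event, so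
    [W n] may be replaced there by [W n.+1], and the part that crosses in this step has
    [W n.+1 >= c]. *)
Lemma ville_step n : (n <= T)%N ->
  (c%:E * P (crossed n) + \int[P]_(w in ~` crossed n) (W n w)%:E <= 1)%E.
Proof.
elim: n => [_|n IH nT].
  (* The process starts at 1, so at time 0 either every path has crossed or none has. *)
  have [c1|c1] := leP c 1.
    have -> : crossed 0 = setT.
      by apply/seteqP; split => // w _; exists 0%N => //; rewrite tilt_process0.
    by rewrite setCT integral_set0 adde0 [X in (_ * X)%E]probability_setT mule1 lee_fin.
  have -> : crossed 0 = set0.
    apply/seteqP; split => // w [t]; rewrite leqn0 => /eqP ->.
    by rewrite tilt_process0 leNgt c1.
  rewrite measure0 mule0 add0e setC0.
  under eq_integral do rewrite tilt_process0.
  by rewrite integral_cst// [X in (_ * X)%E]probability_setT mul1e.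
have nT' := ltnW nT; have {}IH := IH nT'.
have hC : history I r n (crossed n) by exact: history_crossed.
have mC : measurable (crossed n) by exact: (measurable_history inter nT').
have hCc : history I r n (~` crossed n) by exact: (@measurableC _ (hType n)).
have mCc : measurable (~` crossed n) by exact: measurableC.
set B := [set w | c <= W n.+1 w].
have mB : measurable B by apply: (measurable_history inter nT); exact: history_tilt_ge.
have W0 s w : (0 <= (W s w)%:E)%E by rewrite lee_fin expR_ge0.
have mW D : measurable_fun D (fun w => (W n.+1 w)%:E).
  have mWs : measurable_fun [set: Omega] (EFin \o W n.+1).
    by apply/measurable_EFinP; exact: measurable_tilt.
  exact: measurable_funTS mWs.
apply: le_trans IH; rewrite crossedS.
rewrite -(tilt_process_martingale nT hCc).
rewrite -/B; have -> : (\int[P]_(w in ~` crossed n) (W n.+1 w)%:E =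
    \int[P]_(w in ~` crossed n `&` B) (W n.+1 w)%:E +
    \int[P]_(w in ~` crossed n `\` B) (W n.+1 w)%:E)%E.
  rewrite -ge0_integral_setU//; [|exact: measurableI|exact: measurableD|].
    by rewrite setUIDK.
  by apply/disj_setPS => x [[_ ?] []].
have -> : crossed n `|` B = crossed n `|` (~` crossed n `&` B).
  by rewrite setUIr setUv setTI.
rewrite measureU//; last 2 first.
- exact: measurableI.
- by rewrite setIA setICr set0I.
rewrite ge0_muleDr ?measure_ge0// -addeA leeD2l// leeD//; last first.
  by rewrite setUIr setUv setTI setCU setDE.
rewrite -integral_cst; last exact: measurableI.
apply: ge0_le_integral => //.
- exact: measurableI.
- by move=> w _; rewrite lee_fin ltW.
- by move=> w [_ cW]; rewrite lee_fin.
Qed.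

Lemma ville : (P (crossed T) <= (c^-1)%:E)%E.
Proof.
have := ville_step (leqnn T).
have W0 : (0 <= \int[P]_(w in ~` crossed T) (W T w)%:E)%E.
  by apply: integral_ge0 => w _; rewrite lee_fin expR_ge0.
move=> h; have {}h := le_trans (leeDl _ W0) h.
by rewrite -[leRHS]mule1 lee_pdivlMl.
Qed.

End ville.
End tilt_process.

(** * Probabilities and lower integrals *)

Section lower_integral.
Import HBNNSimple.

(* [f] and [g] need not be measurable: for them the integral is the lower one. *)
Lemma ae_le_integralZl d (X : measurableType d) (R : realType)
    (mu : {measure set X -> \bar R}) (H : set X) (f g : X -> R) (c : R) :
  0 < c -> (forall x, 0 <= f x) -> (forall x, 0 <= g x) ->
  {ae mu, forall x, H x -> f x <= c * g x} ->
  (\int[mu]_(x in H) (f x)%:E <= c%:E * \int[mu]_(x in H) (g x)%:E)%E.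
Proof.
move=> c0 f0 g0 [N [mN N0 fgN]].
have nn (h : X -> R) : (forall x, 0 <= h x) ->
    forall x, H x -> (0 <= (h x)%:E)%E by move=> h0 x _; rewrite lee_fin.
rewrite ge0_integralE; last exact: nn.
apply: ge_ereal_sup => _ [h /= hf <-].
have cV0 : 0 <= c^-1 by rewrite invr_ge0 ltW.
(* A simple function below [f], divided by [c] and set to 0 on the null set, lies below [g]; its
   integral is divided by exactly [c]. *)
pose h' := scale_nnsfun (proj_nnsfun h (measurableC mN)) cV0.
have h'E x : h' x = c^-1 * (h x * \1_(~` N) x) by [].
have h'g x : ((h' x)%:E <= (fun x => (g x)%:E) \_ H x)%E.
  rewrite h'E /patch; have := hf x; rewrite /patch; case: ifPn => [Hx|_] hx.
    rewrite lee_fin ler_pdivrMl// indicE; have [xN|xN] := boolP (x \in ~` N).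
      rewrite mulr1; move: hx; rewrite lee_fin => /le_trans; apply.
      apply: contrapT => nfg; move: xN; rewrite inE; apply; apply: fgN => /=.
      by move=> /(_ (set_mem Hx)).
    by rewrite mulr0 mulr_ge0// ltW.
  have -> : h x = 0.
    by apply/eqP; rewrite eq_le; move: hx; rewrite !lee_fin => ->/=.
  by rewrite mul0r mulr0.
have -> : sintegral mu h = (c%:E * sintegral mu h')%E.
  rewrite -!integralT_nnsfun -ge0_integralZl//; last 3 first.
  - exact/measurable_EFinP.
  - by move=> x _; rewrite lee_fin.
  - by rewrite lee_fin ltW.
  apply: ae_eq_integral => //.
  - exact/measurable_EFinP.
  - by apply/measurable_EFinP; apply: measurable_funM.
  exists N; split => // x xN; apply: contrapT => nN; apply: xN => _.
  rewrite -EFinM h'E indicE mem_set// mulr1 mulrA divff ?mul1r//.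
  by rewrite gt_eqF.
rewrite lee_pmul2l ?lte_fin//.
rewrite ge0_integralE; last exact: nn.
by apply: ereal_sup_ubound; exists h'.
Qed.

End lower_integral.

Section max_arm.
Context (R : realType) (K : nat) (f : 'I_K -> R).

Lemma max_arm_ex : (0 < K)%N -> exists a, max_arm f = f a.
Proof.
move=> K0; pose i0 : 'I_K := Ordinal K0.
rewrite /max_arm (bigmax_eq_arg _ i0)//=; last by move=> i _; rewrite leNye.
by eexists.
Qed.

Lemma max_arm_ge a : f a <= max_arm f.
Proof.
have K0 : (0 < K)%N by apply: leq_ltn_trans (ltn_ord a).
rewrite -lee_fin /max_arm fineK; first exact: (le_bigmax _ (fun a => (f a)%:E)).
rewrite (bigmax_eq_arg _ (Ordinal K0))//= => i _; exact: leNye.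
Qed.

End max_arm.

Section probability_measure.
Context (R : realType) d (Omega : measurableType d) (P : probability Omega R).

Definition pr (A : set Omega) : R := fine (P A).

Lemma prE A : measurable A -> P A = (pr A)%:E.
Proof. by move=> mA; rewrite /pr fineK// fin_num_measure. Qed.

Lemma pr_ge0 A : 0 <= pr A.
Proof. exact: fine_ge0. Qed.

Lemma pr_le1 A : measurable A -> pr A <= 1.
Proof. by move=> mA; rewrite -lee_fin -prE// probability_le1. Qed.

Lemma le_pr A B : measurable A -> measurable B -> A `<=` B -> pr A <= pr B.
Proof. by move=> mA mB AB; rewrite -lee_fin -!prE// le_measure ?inE. Qed.

Lemma pr_set0 : pr set0 = 0.
Proof. by rewrite /pr measure0. Qed.

Lemma pr_setU_le A B : measurable A -> measurable B ->
  pr (A `|` B) <= pr A + pr B.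
Proof.
move=> mA mB; rewrite -lee_fin EFinD -!prE//; last exact: measurableU.
exact: measureU2.
Qed.

Lemma pr_sum_disjoint (n : nat) (A : nat -> set Omega) (E : set Omega) :
  (forall i, (i < n)%N -> measurable (A i)) -> measurable E ->
  (forall i, (i < n)%N -> A i `<=` E) ->
  (forall i j w, (i < j < n)%N -> A i w -> A j w -> False) ->
  \sum_(i < n) pr (A i) <= pr E.
Proof.
move=> mA mE AE dis.
suff [H mU]: \sum_(i < n) pr (A i) <= pr (\big[setU/set0]_(i < n) A i)
    /\ measurable (\big[setU/set0]_(i < n) A i).
  apply: (le_trans H); apply: le_pr => //.
  by rewrite -bigcup_mkord => w [i /= ilt]; exact: AE.
elim: n mA AE dis => [|n IH] mA AE dis.
  by rewrite !big_ord0 pr_set0.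
have [|||H mU] := IH.
- by move=> i il; apply: mA; exact: ltnW.
- by move=> i il; apply: AE; exact: ltnW.
- by move=> i j w /andP[ij jn]; apply: dis; rewrite ij ltnW.
rewrite !big_ord_recr/=.
have mAn : measurable (A n) by apply: mA.
split; last exact: measurableU.
rewrite -lee_fin -prE; last exact: measurableU.
rewrite measureU//.
  rewrite EFinD; apply: leeD; last by rewrite -prE.
  by apply: (@le_trans _ _ (pr (\big[setU/set0]_(i < n) A i))%:E);
    rewrite ?lee_fin// -prE.
rewrite -subset0 => w []; rewrite -bigcup_mkord => -[i /= ilt Ai An].
by apply: (dis i n w) => //; rewrite ilt ltnSn.
Qed.

End probability_measure.

(** * Numerical estimates *)

Lemma geometric_expR_sum (R : realType) (e : R) n : 0 < e ->
  \sum_(k < n) expR (- (k.+1%:R * e)) <= e^-1.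
Proof.
move=> e0.
(* Stronger invariant for the induction; its step is [e <= exp e - 1]. *)
suff H : \sum_(k < n) expR (- (k.+1%:R * e)) <= (1 - expR (- (n%:R * e))) / e.
  by apply: (le_trans H); rewrite ler_pdivrMr// mulVf ?gt_eqF// gerBl expR_ge0.
elim: n => [|n IH]; first by rewrite big_ord0 mul0r oppr0 expR0 subrr mul0r.
rewrite big_ord_recr/= (le_trans (lerD IH (lexx _)))//.
rewrite -(ler_pM2r e0) mulrDl !divfK ?gt_eqF//.
have -> : expR (- (n%:R * e)) = expR (- (n.+1%:R * e)) * expR e.
  by rewrite -expRD; congr expR; rewrite -natr1; ring.
have := expR_ge1Dx e; have := expR_gt0 (- (n.+1%:R * e)); nra.
Qed.

Lemma expRN_le_inv (R : realType) (x : R) : 0 <= x -> expR (- x) <= (1 + x)^-1.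
Proof.
move=> x0; rewrite expRN lef_pV2 ?posrE ?expR_gt0 ?ltr_pwDl//.
exact: expR_ge1Dx.
Qed.

(* Telescoping against [sqrt x / (1 + sqrt x)]. *)
Lemma inv_sqrt_expR_sum (R : realType) (e : R) n : 0 < e ->
  \sum_(k < n) expR (- (k.+1%:R * e)) / Num.sqrt (k.+1%:R * e) <= 4 / e.
Proof.
move=> e0; pose G (k : nat) : R := Num.sqrt (k%:R * e) / (1 + Num.sqrt (k%:R * e)).
have G1 k : G k <= 1.
  by rewrite ler_pdivrMr ?mul1r ?ltr_pwDl ?sqrtr_ge0// lerDr.
suff H : \sum_(k < n) expR (- (k.+1%:R * e)) / Num.sqrt (k.+1%:R * e) <= 4 / e * G n.
  by apply: (le_trans H); rewrite ler_piMr// divr_ge0// ltW.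
elim: n => [|n IH]; first by rewrite big_ord0 /G mul0r sqrtr0 mul0r mulr0.
rewrite big_ord_recr/= (le_trans (lerD IH (lexx _)))// -lerBrDl -mulrBr.
rewrite [leRHS]mulrAC ler_pdivlMr//.
rewrite /G; set s := Num.sqrt (n.+1%:R * e); set t := Num.sqrt (n%:R * e).
have s2 : s ^+ 2 = n.+1%:R * e by rewrite sqr_sqrtr// mulr_ge0// ltW.
have t2 : t ^+ 2 = n%:R * e by rewrite sqr_sqrtr// mulr_ge0// ltW.
have s0 : 0 < s by rewrite sqrtr_gt0 mulr_gt0// ltr0n.
have t0 : 0 <= t by exact: sqrtr_ge0.
have st2 : s ^+ 2 - t ^+ 2 = e by rewrite s2 t2 -natr1; ring.
have ts : t <= s by nra.
rewrite -s2; have E := expRN_le_inv (sqr_ge0 s); move: (expR_gt0 (- s ^+ 2)) E.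
set E := expR _ => E0 E1.
have E2 : E * (1 + s ^+ 2) <= 1 by rewrite -ler_pdivlMr ?div1r// ltr_pwDl// sqr_ge0.
have -> : s / (1 + s) - t / (1 + t) = (s - t) / ((1 + s) * (1 + t)).
  by field; rewrite !gt_eqF// ltr_pwDl// ltW.
rewrite mulrA ler_pdivlMr ?mulr_gt0 ?ltr_pwDl ?(ltW s0)//.
rewrite (_ : E / s * e * _ = E * (e * ((1 + s) * (1 + t))) / s); last by ring.
rewrite ler_pdivrMr// [leRHS]mulrC -st2.
(* From [(1 + s)^2 <= 2 (1 + s^2)] and [exp (- s^2) <= 1 / (1 + s^2)]. *)
have b1 : E * (1 + s) ^+ 2 <= 2.
  apply: (@le_trans _ _ (E * (2 * (1 + s ^+ 2)))); last by nra.
  by rewrite ler_pM2l//; have := sqr_ge0 (1 - s); nra.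
have b2 : E * ((1 + s) * (1 + t)) <= 2.
  by apply: le_trans b1; rewrite ler_pM2l// expr2 ler_pM2l ?ltr_pwDl ?(ltW s0)// lerD2l.
have -> : E * ((s ^+ 2 - t ^+ 2) * ((1 + s) * (1 + t))) =
  (s - t) * ((s + t) * (E * ((1 + s) * (1 + t)))) by ring.
have -> : s * (4 * (s - t)) = (s - t) * ((s + s) * 2) by ring.
apply: ler_wpM2l; first by rewrite subr_ge0.
apply: ler_pM => //; [exact: addr_ge0 (ltW s0) t0| |by rewrite lerD2l].
by rewrite !mulr_ge0 ?addr_ge0 ?(ltW s0) ?(ltW E0).
Qed.

(* Telescoping against [z / (1 + z)]. *)
Lemma dyadic_sum (R : realType) (e : R) n : 0 < e ->
  \sum_(j < n) ((2 ^ j)%:R * e) / (1 + (2 ^ j)%:R * e) ^+ 2 <= 2.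
Proof.
move=> e0; pose G (j : nat) : R := ((2 ^ j)%:R * e) / (1 + (2 ^ j)%:R * e).
have z0 j : 0 < (2 ^ j)%:R * e by rewrite mulr_gt0// ltr0n expn_gt0.
have G1 j : G j <= 1.
  by rewrite ler_pdivrMr ?mul1r ?ltr_pwDl ?(ltW (z0 j))// lerDr.
suff H : \sum_(j < n) ((2 ^ j)%:R * e) / (1 + (2 ^ j)%:R * e) ^+ 2 <= 2 * G n.
  by apply: (le_trans H); have := G1 n; lra.
elim: n => [|n IH].
  by rewrite big_ord0 mulr_ge0// divr_ge0 ?addr_ge0// ltW.
rewrite big_ord_recr/= (le_trans (lerD IH (lexx _)))// -lerBrDl -mulrBr /G.
rewrite expnS natrM -(mulrA 2); set z := _ * e.
have {}z0 : 0 < z := z0 n.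
have -> : 2 * z / (1 + 2 * z) - z / (1 + z) = z / ((1 + 2 * z) * (1 + z)).
  by field; rewrite !gt_eqF// ltr_pwDl// ltW// mulr_gt0.
rewrite mulrA ler_pdivrMr ?exprn_gt0 ?ltr_pwDl ?(ltW z0)//.
rewrite mulrAC ler_pdivlMr; last first.
  by rewrite mulr_gt0// ltr_pwDl// ltW// mulr_gt0.
nra.
Qed.

Lemma ln1D_le_sqrt (R : realType) (x : R) : 0 < x -> ln (1 + x) <= 2 * Num.sqrt x.
Proof.
move=> x0; have s0 := sqrtr_ge0 x; have s2 := sqr_sqrtr (ltW x0).
have s1 : 0 < 1 + Num.sqrt x by rewrite ltr_pwDl.
apply: (@le_trans _ _ (ln ((1 + Num.sqrt x) ^+ 2))).
  by rewrite ler_ln ?posrE ?exprn_gt0 ?ltr_pwDl// ?ltW//; nra.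
have h : ln (1 + Num.sqrt x) <= Num.sqrt x.
  by apply: le_ln1Dx; apply: lt_le_trans s0; rewrite ltrN10.
by rewrite lnXn// mulr2n; lra.
Qed.

Lemma expR1_le4 (R : realType) : expR 1 <= 4 :> R.
Proof.
have h := expRN_le_inv (ler01 : 0 <= 1 :> R).
have e0 := expR_gt0 (1 : R).
have : (2 : R)^-1 * 2^-1 <= expR (- 2^-1) * expR (- 2^-1).
  have h1 : (2 : R)^-1 <= expR (- 2^-1) by have := expR_ge1Dx (- 2^-1 : R); lra.
  by apply: ler_pM.
rewrite -expRD (_ : - 2^-1 + - 2^-1 = - 1 :> R); last lra.
rewrite expRN -invfM lef_pV2 ?posrE//; lra.
Qed.

(* Chosen so that [exp (- trunc_level / 2) <= tau^-1 z / (1 + z)], [z = 2^j e]. *)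
Definition trunc_level (R : realType) (tau e : R) (j : nat) : nat :=
  (Num.truncn (2 * ln tau + 2 * ln (1 + ((2 ^ j)%:R * e)^-1))).+1.

(** Within a dyadic block [k.+1] and [2 ^ j] are comparable, and [ln (1 + x) <= 2 sqrt x]. The
    resulting inverse square root is summable by [inv_sqrt_expR_sum]. *)
Lemma trunc_level_le (R : realType) (tau e : R) k : 1 <= tau -> 0 < e ->
  (trunc_level tau e (trunc_log 2 k.+1))%:R <=
  2 * ln tau + 1 + 8 / Num.sqrt (k.+1%:R * e).
Proof.
move=> tau1 e0; have lt0 : 0 <= ln tau by exact: ln_ge0.
set j := trunc_log 2 k.+1; set z := (2 ^ j)%:R * e.
have z0 : 0 < z by rewrite mulr_gt0// ltr0n expn_gt0.
have x0 : 0 < k.+1%:R * e by rewrite mulr_gt0// ltr0n.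
have lz0 : 0 <= ln (1 + z^-1) by rewrite ln_ge0// lerDl invr_ge0 ltW.
rewrite /trunc_level -natr1.
have X0 : 0 <= 2 * ln tau + 2 * ln (1 + z^-1) by rewrite addr_ge0 ?mulr_ge0.
have := truncn_le (2 * ln tau + 2 * ln (1 + z^-1)); rewrite X0 => X1.
rewrite -/j -/z.
have xz : k.+1%:R * e <= 4 * z.
  have : (k.+1 <= 4 * 2 ^ j)%N.
    by have := trunc_log_ltn (k.+1) (ltnSn 1); rewrite -/j expnS; lia.
  by rewrite -(ler_nat R) natrM -(ler_pM2r e0) -mulrA.
have lz : ln (1 + z^-1) <= 4 / Num.sqrt (k.+1%:R * e).
  have zV0 : 0 < z^-1 by rewrite invr_gt0.
  apply: (le_trans (ln1D_le_sqrt zV0)).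
  have -> : 4 / Num.sqrt (k.+1%:R * e) = 2 * Num.sqrt (4 / (k.+1%:R * e)).
    have s4 : Num.sqrt 4 = 2 :> R.
      by rewrite (_ : 4 = 2 ^+ 2); [rewrite sqrtr_sqr ger0_norm|rewrite expr2; lra].
    by rewrite [X in 2 * X]sqrtrM// s4 sqrtrV ?(ltW x0)// mulrA; congr (_ / _); lra.
  rewrite ler_pM2l// ler_wsqrtr// -[leLHS]mul1r ler_pdivrMr//.
  by rewrite mulrAC ler_pdivlMr// mul1r.
lra.
Qed.

Lemma trunc_level_tail (R : realType) (tau e : R) j : 1 <= tau -> 0 < e ->
  expR (- ((trunc_level tau e j)%:R / 2 + (2 ^ j)%:R * e)) <=
  tau^-1 * (((2 ^ j)%:R * e) / (1 + (2 ^ j)%:R * e) ^+ 2).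
Proof.
move=> tau1 e0; set z := (2 ^ j)%:R * e.
have z0 : 0 < z by rewrite mulr_gt0// ltr0n expn_gt0.
have tau0 : 0 < tau by exact: lt_le_trans tau1.
have zV1 : 0 < 1 + z^-1 by rewrite ltr_pwDl// invr_ge0 ltW.
have X1 := truncnS_gt (2 * ln tau + 2 * ln (1 + z^-1)).
apply: (@le_trans _ _ (expR (- ln tau) * (expR (- ln (1 + z^-1)) * expR (- z)))).
  by rewrite -!expRD ler_expR /trunc_level -/z; lra.
rewrite !expRN !lnK ?posrE// ler_wpM2l ?invr_ge0 ?(ltW tau0)//.
rewrite -expRN expr2 [X in _ <= z * X]invfM mulrA; apply: ler_pM.
- by rewrite invr_ge0 ltW.
- exact: expR_ge0.
- by rewrite le_eqVlt; apply/orP; left; apply/eqP; field; rewrite !gt_eqF// ltr_pwDl// ltW.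
- exact: expRN_le_inv (ltW z0).
Qed.

(** Evaluates the bound of [underestimated_pulls]. The levels give [4 (2 ln tau + 1 + 32) / e], the
    tails of the blocks [T * 2 / tau = 2 / e]. *)
Lemma truncation_sum (R : realType) (e : R) (T : nat) :
  0 < e -> 1 <= T%:R * e ->
  \sum_(k < T) (trunc_level (T%:R * e) e (trunc_log 2 k.+1))%:R *
    (expR 1 * expR (- (k.+1%:R * e))) +
  T%:R * \sum_(j < T) expR (- ((trunc_level (T%:R * e) e j)%:R / 2 + (2 ^ j)%:R * e)) <=
  (8 * ln (T%:R * e) + 134) / e.
Proof.
move=> e0; set tau := T%:R * e => tau1.
have tau0 : 0 < tau by exact: lt_le_trans tau1.
have lt0 : 0 <= ln tau by exact: ln_ge0.
have -> : (8 * ln tau + 134) / e = (8 * ln tau + 132) / e + 2 / e.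
  by rewrite -mulrDl; congr (_ / _); lra.
apply: lerD; last first.
  apply: (@le_trans _ _ (T%:R * (tau^-1 * 2))).
    rewrite ler_wpM2l//; apply: (@le_trans _ _ (\sum_(j < T)
      tau^-1 * (((2 ^ j)%:R * e) / (1 + (2 ^ j)%:R * e) ^+ 2))).
      by apply: ler_sum => j _; exact: trunc_level_tail.
    by rewrite -mulr_sumr ler_pM2l ?invr_gt0// dyadic_sum.
  have T0 : T%:R != 0 :> R.
    by apply/eqP => TE; move: tau1; rewrite /tau TE mul0r ler10.
  rewrite le_eqVlt; apply/orP; left; apply/eqP; rewrite /tau.
  by move: T0; set p := _%:R => T0; field; rewrite T0 gt_eqF.
apply: (@le_trans _ _ (\sum_(k < T) 4 * ((2 * ln tau + 1) * expR (- (k.+1%:R * e)) +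
    8 * (expR (- (k.+1%:R * e)) / Num.sqrt (k.+1%:R * e))))).
  apply: ler_sum => k _; rewrite mulrCA.
  have h := trunc_level_le k tau1 e0; have E0 := expR_ge0 (- (k.+1%:R * e)).
  apply: ler_pM => //.
  - exact: expR1_le4.
  - by apply: (le_trans (ler_wpM2r E0 h)); rewrite mulrDl lerD2l mulrAC -mulrA.
rewrite -mulr_sumr big_split/= -!mulr_sumr.
have h1 := geometric_expR_sum T e0; have h2 := inv_sqrt_expR_sum T e0.
apply: (@le_trans _ _ (4 * ((2 * ln tau + 1) * e^-1 + 8 * (4 / e)))).
  rewrite ler_pM2l//; apply: lerD; last by rewrite ler_pM2l.
  by apply: ler_wpM2l => //; lra.
by rewrite le_eqVlt; apply/orP; left; apply/eqP; field; rewrite gt_eqF.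
Qed.

Lemma ln_ge_half (R : realType) (k : R) : 2 <= k -> 2^-1 <= ln k.
Proof.
move=> k2; have k0 : 0 < k by lra.
apply: (@le_trans _ _ (ln 2)); last by rewrite ler_ln ?posrE.
have h : ln (1 + - 2^-1) <= - 2^-1 :> R by apply: le_ln1Dx; lra.
have e2 : 1 + - 2^-1 = 2^-1 :> R by lra.
by move: h; rewrite e2 lnV ?posrE//; lra.
Qed.

(** In the variables [w = g t / (16 r)] and [p] the hypothesis on [g] reads [p < w], and [t] times
    the rate is [w^2]. The claim becomes [(9 ln (w^2) + 137) / w <= 328 l / p], which follows from
    [ln w <= ln p + w / p - 1] and [ln p <= l]. *)
Lemma arm_term (R : realType) (g V t k : R) : 0 < V -> 0 < t -> 2 <= k ->
  16 * Num.sqrt (V * k * ln k / t) < g ->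
  1 <= t * ((g / 4) ^+ 2 / (16 * V)) /\
  g * ((9 * ln (t * ((g / 4) ^+ 2 / (16 * V))) + 137) / ((g / 4) ^+ 2 / (16 * V)))
  <= 5248 * (Num.sqrt (V * t) * (ln k / Num.sqrt (k * ln k))).
Proof.
move=> V0 t0 k2 gk; have l2 := ln_ge_half k2; set l := ln k in l2 gk *.
have k0 : 0 < k by lra.
have l0 : 0 < l by lra.
have kl0 : 0 < k * l by rewrite mulr_gt0.
set p := Num.sqrt (k * l); set r := Num.sqrt (V * t).
have p0 : 0 < p by rewrite sqrtr_gt0.
have r0 : 0 < r by rewrite sqrtr_gt0 mulr_gt0.
have p2 : p ^+ 2 = k * l by rewrite sqr_sqrtr// ltW.
have r2 : r ^+ 2 = V * t by rewrite sqr_sqrtr// ltW// mulr_gt0.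
have p1 : 1 <= p.
  have : 1 ^+ 2 <= p ^+ 2 by rewrite p2; nra.
  by rewrite ler_pXn2r ?nnegrE// ltW.
have sE : Num.sqrt (V * k * l / t) = p * r / t.
  have -> : V * k * l / t = (p * r / t) ^+ 2.
    by rewrite !exprMn p2 r2; field; rewrite gt_eqF.
  by rewrite sqrtr_sqr ger0_norm// divr_ge0 ?mulr_ge0// ltW.
have g0 : 0 < g.
  by apply: le_lt_trans gk; rewrite mulr_ge0 ?sqrtr_ge0.
pose w := g * t / (16 * r).
have w0 : 0 < w by rewrite divr_gt0 ?mulr_gt0.
have pw : p < w.
  rewrite /w ltr_pdivlMr ?mulr_gt0//; move: gk; rewrite sE mulrA ltr_pdivrMr//; lra.
have V_neq0 : V != 0 by rewrite gt_eqF.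
have t_neq0 : t != 0 by rewrite gt_eqF.
have r_neq0 : r != 0 by rewrite gt_eqF.
have g_neq0 : g != 0 by rewrite gt_eqF.
have w_neq0 : w != 0 by rewrite gt_eqF.
have VE : V = r ^+ 2 / t by rewrite r2; field.
have teE : t * ((g / 4) ^+ 2 / (16 * V)) = w ^+ 2.
  by rewrite VE /w; field; rewrite r_neq0.
rewrite teE; split; first by rewrite expr_ge1//; lra.
have -> : g * ((9 * ln (w ^+ 2) + 137) / ((g / 4) ^+ 2 / (16 * V))) =
    16 * (r * ((9 * ln (w ^+ 2) + 137) / w)).
  rewrite VE /w; move: (ln _) => L; field; rewrite ?r_neq0 ?t_neq0 ?g_neq0//.
have -> : 5248 * (r * (l / p)) = 16 * (r * (328 * l / p)).
  by field; rewrite gt_eqF.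
rewrite ler_pM2l// ler_pM2l// ler_pdivrMr// mulrAC ler_pdivlMr//.
have lnw : ln w <= ln p + (w / p - 1).
  have -> : ln w = ln p + ln (1 + (w / p - 1)).
    have wp0 : 0 < w / p by rewrite divr_gt0.
    by rewrite subrKC -lnM// mulrC divfK// gt_eqF.
  rewrite lerD2l; apply: le_ln1Dx.
  have : 0 < w / p by rewrite divr_gt0.
  by lra.
have lnp : 2 * ln p <= 2 * l.
  have -> : 2 * ln p = ln (p ^+ 2) by rewrite lnXn// mulr2n; lra.
  rewrite p2 lnM ?posrE// -/l.
  have : ln (1 + (l - 1)) <= l - 1 by apply: le_ln1Dx; lra.
  by rewrite subrKC; lra.
have lnp0 : 0 <= ln p by exact: ln_ge0.
have pl : p * ln w <= w * ln p + w.
  apply: (@le_trans _ _ (p * (ln p + (w / p - 1)))); first by rewrite ler_pM2l.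
  have -> : p * (ln p + (w / p - 1)) = p * ln p + w - p by field; rewrite gt_eqF.
  by have := ler_wpM2r lnp0 (ltW pw); lra.
rewrite lnXn// mulr2n.
(* Here [155 = 18 + 137], and [155 <= 310 l] since [l >= 1/2]; thus [328 = 18 + 310], and
   [5248 = 16 * 328]. *)
have : w * (18 * ln p + 155) <= w * (328 * l) by rewrite ler_pM2l//; lra.
nra.
Qed.

(** * Regret of Exp-KL-MS *)

Section algorithm.
Context (R : realType) (m : {measure set (measurableTypeR R) -> \bar R})
  (Theta : set R) (V : R) (K T : nat)
  (nu : 'I_K -> probability (measurableTypeR R) R)
  d (Omega : measurableType d) (P : probability Omega R)
  (I : nat -> Omega -> 'I_K) (r : nat -> Omega -> R).
Hypothesis K2 : (2 <= K)%N.
Hypothesis itvTheta : is_interval Theta.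
Hypothesis Z_gt0_lty :
  forall theta, Theta theta -> (0 < partition_fun m theta < +oo)%E.
Hypothesis varV :
  forall q, exp_family m Theta q -> ('V_q[(fun x => x)] <= V%:E)%E.
Hypothesis nuF : forall a, exp_family m Theta (nu a).
Hypothesis inter : bandit_interaction P nu T I r.
Hypothesis follows : follows_exp_KL_MS m Theta P T I r.
Hypothesis means_in : emp_means_in_family m Theta P T I r.

Local Notation hType t := (g_sigma_algebraType (history_gen I r t)).
Local Notation N := (pull_count I).
Local Notation KLm := (KL m Theta).
Local Notation fam := (family_mean m Theta).
Local Notation muhat := (emp_mean I r).
Local Notation muhat_max := (emp_mean_max I r).
Local Notation pr := (pr P).

Let K0 : (0 < K)%N. Proof. exact: ltnW. Qed.

Definition good (w : Omega) := forall t a, (1 <= t <= T)%N -> (0 < N t a w)%N ->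
  fam (muhat t a w).

Lemma good_ae : {ae P, forall w, good w}.
Proof. exact: means_in. Qed.

Lemma pull_count_mono s t a w : (s <= t)%N -> (N s a w <= N t a w)%N.
Proof.
move=> /subnK <-; elim: (t - s)%N => // n IH.
by rewrite addSn pull_countS (leq_trans IH)// leq_addr.
Qed.

Lemma pull_count_gt0 t a w : (K <= t <= T)%N -> (0 < N t a w)%N.
Proof.
move=> /andP[Kt tT]; have aK := ltn_ord a.
apply: leq_trans (pull_count_mono a w (leq_trans aK Kt)).
(* Arms are numbered from 0 and rounds from 1, so the initial pull of [a] is in round [a.+1]. *)
rewrite pull_countS (_ : I a.+1 w == a) ?addn1//.
apply/eqP/val_inj => /=; rewrite follows.1//.
by rewrite /= (leq_trans aK) ?(leq_trans Kt).
Qed.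

Lemma pull_count_le t a w : (N t a w <= t)%N.
Proof.
elim: t => [|t IH]; first by rewrite /pull_count big_geq.
by rewrite pull_countS -addn1 leq_add// leq_b1.
Qed.

(** * Sampling probabilities in one round *)

Section round.
Variables (t : nat) (w : Omega).
Hypothesis tT : (K < t <= T)%N.
Hypothesis gw : good w.
Local Notation wt a := (exp_KL_MS_weight m Theta I r t a w).

Let t1T : (1 <= t.-1 <= T)%N.
Proof. by move: tT K0; lia. Qed.

Let Kt1 : (K <= t.-1 <= T)%N.
Proof. by move: tT; lia. Qed.

Lemma muhat_family a : fam (muhat t.-1 a w).
Proof. by apply: gw => //; exact: pull_count_gt0. Qed.

Lemma muhat_max_family : fam (muhat_max t.-1 w).
Proof.
by rewrite /emp_mean_max; have [a ->] := max_arm_ex (muhat t.-1 ^~ w) K0;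
  exact: muhat_family.
Qed.

Let N1 a : 1 <= (N t.-1 a w)%:R :> R.
Proof. by rewrite ler1n; exact: pull_count_gt0. Qed.

Let KL0 a : 0 <= KLm (muhat t.-1 a w) (muhat_max t.-1 w).
Proof. exact: (KL_family_ge0 Z_gt0_lty varV (muhat_family a) muhat_max_family). Qed.

Lemma weight_le1 a : wt a <= 1.
Proof.
rewrite /exp_KL_MS_weight -[leRHS]expR0 ler_expR oppr_le0 mulr_ge0 ?KL0//.
by rewrite subr_ge0 N1.
Qed.

(** The empirically best arm has divergence 0, hence weight 1. *)
Lemma weight_sum_ge1 : 1 <= \sum_(a < K) wt a.
Proof.
have [a aE] := max_arm_ex (muhat t.-1 ^~ w) K0.
rewrite (bigD1 a)//= ler_wpDr//; first by apply: sumr_ge0 => b _; exact: expR_ge0.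
rewrite /exp_KL_MS_weight /emp_mean_max aE.
by rewrite (KL_family_refl varV (muhat_family a)) mulr0 oppr0 expR0.
Qed.

Lemma prob_le_weight a : exp_KL_MS_prob m Theta I r t a w <= wt a.
Proof.
rewrite /exp_KL_MS_prob ler_pdivrMr; last exact: lt_le_trans weight_sum_ge1.
by rewrite ler_peMr ?expR_ge0// weight_sum_ge1.
Qed.

(** The weight of [a] is at most 1, and the weight of [b] is an exponential with factor [N - 1];
    using [N] instead only enlarges the bound. *)
Lemma prob_le_ratio a b :
  exp_KL_MS_prob m Theta I r t a w <=
  expR ((N t.-1 b w)%:R * KLm (muhat t.-1 b w) (muhat_max t.-1 w)) *
  exp_KL_MS_prob m Theta I r t b w.
Proof.
rewrite /exp_KL_MS_prob mulrA ler_wpM2r//.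
  by rewrite invr_ge0 (le_trans _ weight_sum_ge1).
apply: (le_trans (weight_le1 a)).
rewrite /exp_KL_MS_weight -expRD -[leLHS]expR0 ler_expR.
rewrite mulrBl mul1r opprB addrC subrK; exact: KL0.
Qed.

End round.

Lemma prob_ge0 t a w : 0 <= exp_KL_MS_prob m Theta I r t a w.
Proof.
by rewrite divr_ge0 ?expR_ge0//; apply: sumr_ge0 => b _; exact: expR_ge0.
Qed.

Section sampling.
Variables (t : nat) (H : set Omega) (c : R).
Hypothesis tT : (K < t <= T)%N.
Hypothesis hH : history I r t.-1 H.
Hypothesis c0 : 0 < c.

Let mH : measurable H.
Proof. by apply: (measurable_history inter _ hH); move: tT; lia. Qed.

Let mI a : measurable (H `&` I t @^-1` [set a]).
Proof.
apply: measurableI => //; apply: (pull_event_measurable inter).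
by move: tT; lia.
Qed.

Let sampleE a : (P (H `&` (I t @^-1` [set a])) =
  \int[P]_(w in H) (exp_KL_MS_prob m Theta I r t a w)%:E)%E.
Proof.
have [_] := follows; apply => //; move: tT; lia.
Qed.

(** The weight bound holds on [good] paths only, and the sampling probability is compared without a
    measurability statement; [ae_le_integralZl] handles both. *)
Lemma sampling_le a :
  (forall w, good w -> H w ->
    expR (- (((N t.-1 a w)%:R - 1) * KLm (muhat t.-1 a w) (muhat_max t.-1 w))) <= c) ->
  pr (H `&` I t @^-1` [set a]) <= c * pr H.
Proof.
move=> hc; rewrite -lee_fin EFinM -!prE// sampleE.
rewrite -[X in (_ <= _ * X)%E]mul1e -(integral_cst _ mH 1%E).
apply: (@ae_le_integralZl _ _ _ _ _ _ (fun=> 1)) => //; first by move=> w; exact: prob_ge0.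
have [A [mA A0 sub]] := good_ae; exists A; split => //.
apply: subset_trans sub => w /= nw gw; apply: nw => Hw.
by rewrite mulr1; apply: le_trans (hc _ gw Hw); exact: prob_le_weight.
Qed.

Lemma sampling_ratio a b :
  (forall w, good w -> H w ->
    expR ((N t.-1 b w)%:R * KLm (muhat t.-1 b w) (muhat_max t.-1 w)) <= c) ->
  pr (H `&` I t @^-1` [set a]) <= c * pr (H `&` I t @^-1` [set b]).
Proof.
move=> hc; rewrite -lee_fin EFinM -!prE// !sampleE.
apply: ae_le_integralZl => //; [by move=> w; exact: prob_ge0|by move=> w; exact: prob_ge0|].
have [A [mA A0 sub]] := good_ae; exists A; split => //.
apply: subset_trans sub => w /= nw gw; apply: nw => Hw.
apply: le_trans (prob_le_ratio tT gw a b) _.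
by rewrite ler_wpM2r ?prob_ge0// hc.
Qed.

End sampling.

(** * Measurability of the statistics and deviation events *)

Local Notation mu a := (mean (nu a)).

Lemma mu_family a : fam (mu a).
Proof. by exists (nu a) => //; exact: nuF. Qed.

Lemma cum_reward_muhat t a w :
  cum_reward I r t a w = (N t a w)%:R * muhat t a w.
Proof.
rewrite /emp_mean mulrC; have [N0|N0] := eqVneq (N t a w) 0%N; last first.
  by rewrite divfK// pnatr_eq0.
rewrite N0 invr0 !mulr0 /cum_reward.
elim: t N0 => [|t IH]; first by rewrite big_geq.
rewrite pull_countS => /eqP; rewrite addn_eq0 => /andP[/eqP Nt].
by rewrite eqb0 big_mkcond big_nat_recr//= -big_mkcond IH// => /negbTE ->; rewrite addr0.
Qed.

(** Division by the count is written as [exp (- ln N)], a composition of measurable maps; when the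
    count is 0 both sides vanish because the reward sum is empty. *)
Lemma history_measurable_muhat t a :
  measurable_fun setT (muhat t a : hType t -> R).
Proof.
have -> : (muhat t a : hType t -> R) =
    (fun w => cum_reward I r t a w * expR (- ln (N t a w)%:R)).
  apply/funext => w; rewrite cum_reward_muhat.
  have [N0|N0] := posnP (N t a w).
    by rewrite N0 mul0r mul0r /emp_mean N0 invr0 mulr0.
  by rewrite expRN lnK ?posrE ?ltr0n// mulrAC divff ?mul1r// pnatr_eq0 -lt0n.
apply: measurable_funM; first exact: history_measurable_cum.
apply: measurableT_comp => //; apply: measurableT_comp => //.
by apply: measurableT_comp; [exact: measurable_ln|exact: history_measurable_count].
Qed.

Lemma history_muhat t a (D : set (measurableTypeR R)) : measurable D ->
  history I r t [set w | D (muhat t a w)].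
Proof.
move=> mD; have := @history_measurable_muhat t a measurableT D mD.
by rewrite setTI.
Qed.

Lemma history_count_eq t a k : history I r t [set w | N t a w = k].
Proof.
have := @history_measurable_count _ _ _ _ I r t a measurableT [set k%:R] (measurable_set1 _).
rewrite setTI; congr (_.-measurable _); apply/seteqP; split => w /= => [/eqP|->//].
by rewrite eqr_nat => /eqP.
Qed.

Lemma history_count t a (Q : pred nat) : history I r t [set w | Q (N t a w)].
Proof.
have -> : [set w | Q (N t a w)] = \bigcup_(k in [set k | Q k]) [set w | N t a w = k].
  apply/seteqP; split => [w Qw|w [k /= Qk Nk]]; first by exists (N t a w).
  by rewrite /= Nk.
apply: (@bigcup_measurable _ (hType t)) => k _; exact: history_count_eq.
Qed.

Lemma muhat_max_leP t w y : reflect (forall a, muhat t a w <= y) (muhat_max t w <= y).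
Proof.
apply: (iffP idP) => [h a|h]; first exact: le_trans (max_arm_ge _ a) h.
by rewrite /emp_mean_max; have [a ->] := max_arm_ex (muhat t ^~ w) K0.
Qed.

Lemma history_muhat_max t y : history I r t [set w | muhat_max t w <= y].
Proof.
have -> : [set w | muhat_max t w <= y] =
    \bigcap_(a in [set: 'I_K]) [set w | `]-oo, y]%classic (muhat t a w)].
  apply/seteqP; split => w /=.
    by move=> /muhat_max_leP h a _ /=; rewrite in_itv/=.
  by move=> h; apply/muhat_max_leP => a; have := h a Logic.I; rewrite /= in_itv.
apply: (@fin_bigcap_measurable _ (hType t)) => // a _.
by apply: history_muhat; exact: measurable_itv.
Qed.

Lemma history_setI t A B : history I r t A -> history I r t B ->
  history I r t (A `&` B).
Proof. exact: (@measurableI _ (hType t)). Qed.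

Lemma history_setC t A : history I r t A -> history I r t (~` A).
Proof. exact: (@measurableC _ (hType t)). Qed.

(** The event is the crossing of [exp (n (l x - k))] by the tilted process. A single event thus
    serves all times with at least [n] pulls, with no union over time. *)
Lemma tail_event a l k x n :
  (\int[nu a]_z (expR (l * z - k))%:E = 1)%E -> 0 <= l * x - k ->
  exists E, [/\ measurable E,
    forall t w, (t <= T)%N -> (n <= N t a w)%N -> l * x <= l * muhat t a w -> E w &
    pr E <= expR (- (n%:R * (l * x - k)))].
Proof.
move=> mgf1 lxk; pose c := expR (n%:R * (l * x - k)).
have c0 : 0 < c by exact: expR_gt0.
have mE : measurable (crossed I r a l k c T).
  by apply: (measurable_history inter (leqnn T)); exact: history_crossed.
exists (crossed I r a l k c T); split => //.
- move=> t w tT nN lxm; exists t => //.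
  rewrite /c /tilt_process ler_expR cum_reward_muhat.
  have -> : l * ((N t a w)%:R * muhat t a w) - k * (N t a w)%:R =
    (N t a w)%:R * (l * muhat t a w - k) by ring.
  by rewrite ler_pM ?ler_nat// lerB.
- by rewrite expRN -lee_fin -prE//; exact: (ville inter).
Qed.

Lemma bad_null : exists G, [/\ measurable G, pr G = 0 & forall w, ~ good w -> G w].
Proof.
have [G [mG G0 sub]] := good_ae; exists G; split => //.
by rewrite /pr G0.
Qed.

Hypothesis V0 : 0 < V.

(** The rate has two parts: the divergence to [y] will pay for the sampling ratio, and the quadratic
    term gives decay in the number of pulls. The tilt [l] is nonpositive, which reverses the
    inequality on the mean. *)
Lemma lower_event s x y n : fam x -> fam y -> x <= y -> y < mu s ->
  exists E, [/\ measurable E,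
    forall t w, (t <= T)%N -> (n <= N t s w)%N -> muhat t s w <= x -> E w &
    pr E <= expR (- (n%:R * (KLm x y + (mu s - y) ^+ 2 / (16 * V))))].
Proof.
move=> fx fy xy ys.
have [l [k [l0 mgf1 lk]]] := lower_tilt itvTheta Z_gt0_lty varV (nuF s) fx fy xy ys.
have V16 : 0 < 16 * V by rewrite mulr_gt0.
have kl0 : 0 <= KLm x y := KL_family_ge0 Z_gt0_lty varV fx fy.
have rate : KLm x y + (mu s - y) ^+ 2 / (16 * V) <= l * x - k.
  by rewrite -lerBrDl ler_pdivrMr// mulrC.
have lxk0 : 0 <= l * x - k.
  by apply: le_trans rate; rewrite addr_ge0// divr_ge0 ?sqr_ge0// ltW.
have [E [mE EP prE]] := tail_event n mgf1 lxk0.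
exists E; split => //.
- by move=> t w tT nN mx; apply: (EP t) => //; exact: ler_wnM2l.
- by apply: (le_trans prE); rewrite ler_expR lerN2 ler_wpM2l.
Qed.

Lemma upper_event a x n : mu a < x -> (0 < n)%N ->
  exists E, [/\ measurable E,
    forall t w, (1 <= t <= T)%N -> (n <= N t a w)%N -> x <= muhat t a w -> E w &
    pr E <= expR (- (n%:R * ((x - mu a) ^+ 2 / (16 * V))))].
Proof.
move=> ax n0; have V16 : 0 < 16 * V by rewrite mulr_gt0.
(* Family means form an interval containing [mu a], so an empirical mean can pass a point outside
   the family only on the null set. *)
have [fx|nfx] := pselect (fam x); last first.
  have [G [mG G0 bad]] := bad_null; exists G; split => //; last first.
    by rewrite G0 expR_ge0.
  move=> t w tT nN xm; apply: bad => gw; apply: nfx.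
  have fm := gw t a tT (leq_trans n0 nN).
  apply: (family_mean_itv itvTheta Z_gt0_lty varV (mu_family a) fm).
  by rewrite (ltW ax).
have [l [k [l0 mgf1 lk]]] := upper_tilt itvTheta Z_gt0_lty varV (nuF a) fx ax.
have rate : (x - mu a) ^+ 2 / (16 * V) <= l * x - k.
  by rewrite ler_pdivrMr// mulrC.
have lxk0 : 0 <= l * x - k.
  by apply: le_trans rate; rewrite divr_ge0 ?sqr_ge0// ltW.
have [E [mE EP prE]] := tail_event n mgf1 lxk0.
exists E; split => //.
- by move=> t w /andP[_ tT] nN mx; apply: (EP t) => //; exact: ler_wpM2l.
- by apply: (le_trans prE); rewrite ler_expR lerN2 ler_wpM2l.
Qed.

(* A half-line (or the empty set) of reals standing for [{z | u < KL z y}], so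
   that no measurability of [KL] is needed. *)
Lemma level_set s y u : fam y -> y < mu s -> 0 <= u ->
  exists D : set (measurableTypeR R), [/\ measurable D,
    forall z, fam z -> z <= y -> ~ D z -> KLm z y <= u &
    forall n, exists E, [/\ measurable E,
      forall t w, (t <= T)%N -> (n <= N t s w)%N -> D (muhat t s w) -> E w &
      pr E <= expR (- (n%:R * (u + (mu s - y) ^+ 2 / (16 * V))))]].
Proof.
move=> fy ys u0.
have [[x [fx xy xu]]|none] := pselect (exists x, [/\ fam x, x <= y & u < KLm x y]).
  have u01 : 0 <= u <= KLm x y by rewrite u0 ltW.
  have [x' [fx' xy' xu']] := KL_family_level itvTheta Z_gt0_lty varV fx fy xy u01.
  exists `]-oo, x']%classic; split; first exact: measurable_itv.
    move=> z fz zy; rewrite /= in_itv/= => /negP; rewrite -ltNge => /ltW xz.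
    rewrite -xu'; exact: (KL_family_mono_left Z_gt0_lty varV fx' fz fy).
  move=> n; have [E [mE EP prE]] := lower_event n fx' fy xy' ys.
  exists E; split => //; last by rewrite -xu'.
exists set0; split => //.
- by move=> z fz zy _; rewrite leNgt; apply/negP => uz; apply: none; exists z.
- by move=> n; exists set0; split => //; rewrite pr_set0 expR_ge0.
Qed.

(** * Expected pulls of an arm after the initial rounds *)

Let n0 := (T - K)%N.
(** The pull after [K + i] completed rounds, whose past is [history I r (K + i)]. *)
Let A i (a : 'I_K) : set Omega := I (K + i).+1 @^-1` [set a].

Let pastT i : (i < n0)%N -> (K + i < T)%N.
Proof. by rewrite /n0; lia. Qed.

Let roundT i : (i < n0)%N -> (K < (K + i).+1 <= T)%N.
Proof. by rewrite /n0; lia. Qed.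

Let mpast i H : (i < n0)%N -> history I r (K + i) H -> measurable H.
Proof. by move=> /pastT/ltnW iT; exact: (measurable_history inter iT). Qed.

Let mA i a : (i < n0)%N -> measurable (A i a).
Proof.
move=> /roundT iT; apply: (pull_event_measurable inter).
by move: iT; lia.
Qed.

(** A pull raises the count, so [b] is pulled at most once while its count is [k]: the events are
    disjoint over rounds, and a time-uniform event [E] is paid for only once. *)
Lemma pulls_at_count b k (F : nat -> set Omega) E :
  (forall i, (i < n0)%N -> measurable (F i)) -> measurable E ->
  (forall i w, (i < n0)%N -> N (K + i) b w = k -> F i w -> E w) ->
  \sum_(i < n0) pr (([set w | N (K + i) b w = k] `&` F i) `&` A i b) <= pr E.
Proof.
move=> mF mE FE.
apply: (@pr_sum_disjoint _ _ _ P n0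
  (fun i => ([set w | N (K + i) b w = k] `&` F i) `&` A i b) E).
- move=> i ni; apply: measurableI; last exact: mA.
  apply: measurableI; last exact: mF.
  by apply: (mpast ni); exact: history_count_eq.
- exact: mE.
- by move=> i ni w [[/= Nk Fi] _]; exact: FE Nk Fi.
- move=> i j w /andP[ij _] [[/= Nk _] Aib] [[/= Nk' _] _].
  have : (N (K + i).+1 b w <= N (K + j) b w)%N.
    by apply: pull_count_mono; rewrite ltn_add2l.
  by rewrite pull_countS Nk Nk' (_ : I (K + i).+1 w == b) ?addn1 ?ltnn//; apply/eqP.
Qed.

Lemma le_pr_bigU n (B : nat -> set Omega) (C : set Omega) : measurable C ->
  (forall k, (k < n)%N -> measurable (B k)) ->
  (forall w, C w -> exists2 k, (k < n)%N & B k w) ->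
  pr C <= \sum_(k < n) pr (B k).
Proof.
move=> mC mB CB.
have mU l : (l <= n)%N -> measurable (\big[setU/set0]_(k < l) B k).
  move=> ln; apply: bigsetU_measurable => k _; apply: mB.
  exact: leq_trans (ltn_ord k) ln.
apply: (@le_trans _ _ (pr (\big[setU/set0]_(k < n) B k))).
  apply: le_pr => //; first exact: mU.
  by rewrite -bigcup_mkord => w /CB[k kn Bk]; exists k.
have : (n <= n)%N by [].
elim: {-2}n => [_|l IH ln]; first by rewrite !big_ord0 pr_set0.
rewrite !big_ord_recr/=; apply: le_trans (pr_setU_le _ _ _) _.
- by apply: mU; exact: ltnW.
- exact: mB.
- by rewrite lerD2r IH// ltnW.
Qed.

Lemma few_pulls a u :
  \sum_(i < n0) pr ([set w | (N (K + i) a w <= u)%N] `&` A i a) <= u.+1%:R.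
Proof.
apply: (@le_trans _ _ (\sum_(i < n0) \sum_(k < u.+1)
    pr (([set w | N (K + i) a w = k] `&` setT) `&` A i a))).
  apply: ler_sum => i _; have ni := ltn_ord i.
  apply: (@le_pr_bigU u.+1 (fun k => ([set w | N (K + i) a w = k] `&` setT) `&` A i a)).
  - apply: measurableI; last exact: mA.
    by apply: (mpast ni); exact: (@history_count (K + i) a (fun c => (c <= u)%N)).
  - move=> k _; rewrite setIT; apply: measurableI; last exact: mA.
    by apply: (mpast ni); exact: history_count_eq.
  - by move=> w [/= Nu Aw]; exists (N (K + i) a w).
rewrite exchange_big/= -[u.+1 in leRHS]card_ord -sumr_const.
apply: ler_sum => k _; apply: le_trans (pr_le1 P measurableT).
exact: (@pulls_at_count a k (fun=> setT) setT).
Qed.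

(** Sorting by the count, each value [k.+1] costs one tail bound, and these form a geometric series.
    Count 0 is excluded by the initial pulls. *)
Lemma overestimated_pulls a eps : 0 < eps ->
  \sum_(i < n0) pr ([set w | mu a + eps <= muhat (K + i) a w] `&` A i a) <=
  (eps ^+ 2 / (16 * V))^-1.
Proof.
move=> e0; set eta := eps ^+ 2 / _.
have eta0 : 0 < eta by rewrite divr_gt0 ?exprn_gt0// mulr_gt0.
pose F i := [set w | mu a + eps <= muhat (K + i) a w].
have hF i : history I r (K + i) (F i).
  rewrite (_ : F i = [set w | `[mu a + eps, +oo[%classic (muhat (K + i) a w)]).
    by apply: history_muhat; exact: measurable_itv.
  by apply/seteqP; split => w; rewrite /F /= in_itv/= andbT.
have mF i : (i < n0)%N -> measurable (F i) by move=> ni; exact: mpast ni (hF i).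
apply: le_trans (geometric_expR_sum T eta0).
apply: (@le_trans _ _ (\sum_(i < n0) \sum_(k < T)
    pr (([set w | N (K + i) a w = k.+1] `&` F i) `&` A i a))).
  apply: ler_sum => i _; have ni := ltn_ord i.
  apply: (@le_pr_bigU T (fun k => ([set w | N (K + i) a w = k.+1] `&` F i) `&` A i a)).
  - by apply: measurableI; [exact: mF|exact: mA].
  - move=> k _; apply: measurableI; last exact: mA.
    apply: measurableI; last exact: mF.
    by apply: (mpast ni); exact: history_count_eq.
  - move=> w [Fw Aw]; have iT := pastT ni.
    have Ngt : (0 < N (K + i) a w)%N.
      by apply: pull_count_gt0; rewrite leq_addr ltnW.
    exists (N (K + i) a w).-1.
      by rewrite prednK// (leq_trans (pull_count_le _ _ _))// ltnW.
    by split => //; split => //=; rewrite prednK.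
rewrite exchange_big/=; apply: ler_sum => k _.
have ax : mu a < mu a + eps by rewrite ltrDl.
have [E [mE EP prE]] := upper_event ax (ltn0Sn k).
move: prE; rewrite addrC addKr -/eta; apply: le_trans.
apply: (@pulls_at_count a k.+1 F E mF mE) => i w ni Nk Fw.
apply: (EP (K + i)%N) => //; last by rewrite Nk.
by rewrite (ltnW (pastT ni)) andbT addn_gt0 K0.
Qed.

(** On this event the best empirical mean exceeds that of [a] by more than [2 * eps], hence by
    [eps], so every round has a small sampling probability; [u < N] gives [u <= N - 1], as the
    weight requires. *)
Lemma well_estimated_pulls a s eps u : 0 < eps -> mu a + 4 * eps = mu s ->
  \sum_(i < n0) pr ((([set w | (u < N (K + i) a w)%N] `&`
     ~` [set w | mu a + eps <= muhat (K + i) a w]) `&`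
     ~` [set w | muhat_max (K + i) w <= mu s - eps]) `&` A i a) <=
  T%:R * expR (- (u%:R * (eps ^+ 2 / (16 * V)))).
Proof.
move=> e0 gapE; set eta := eps ^+ 2 / _; set c := expR _.
apply: (@le_trans _ _ (\sum_(i < n0) c)); last first.
  rewrite sumr_const card_ord -[leLHS]mulr_natl ler_wpM2r ?expR_ge0// ler_nat.
  exact: leq_subr.
apply: ler_sum => i _; have ni := ltn_ord i; set H := (X in pr (X `&` _)).
have hH : history I r (K + i) H.
  apply: history_setI.
    apply: history_setI; first exact: (@history_count (K + i) a (fun c => (u < c)%N)).
    apply: history_setC.
    rewrite (_ : [set w | _] = [set w | `[mu a + eps, +oo[%classic (muhat (K + i) a w)]).
      by apply: history_muhat; exact: measurable_itv.
    by apply/seteqP; split => w; rewrite /= in_itv/= andbT.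
  by apply: history_setC; exact: history_muhat_max.
have c0 : 0 < c by exact: expR_gt0.
apply: (@le_trans _ _ (c * pr H)); last first.
  by rewrite ler_piMr ?expR_ge0// pr_le1//; exact: mpast ni hH.
apply: (sampling_le (roundT ni) hH c0).
move=> w gw [[/= uN /negP]]; rewrite -ltNge => muha /negP; rewrite -ltNge => muhm.
have fa := muhat_family (roundT ni) gw a.
have fm := muhat_max_family (roundT ni) gw.
rewrite /= in fa fm.
rewrite ler_expR lerN2; apply: ler_pM => //.
- by rewrite divr_ge0 ?sqr_ge0// mulr_ge0// ltW.
- by rewrite lerBrDr natr1 ler_nat.
- rewrite ler_pdivrMr ?mulr_gt0// mulrC.
  apply: le_trans (KL_family_lower itvTheta Z_gt0_lty varV fa fm).
  rewrite -[leRHS]sqrrN opprB lerXn2r ?nnegrE//; lra.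
Qed.

Lemma exit_index (C : nat -> Prop) n : C 0%N -> ~ C n ->
  exists2 v, (v < n)%N & C v /\ ~ C v.+1.
Proof.
move=> C0; elim: n => [//|n IH nC].
have [Cn|nCn] := pselect (C n); first by exists n.
by have [v vn Cv] := IH nCn; exists v => //; exact: leqW.
Qed.

(** Case (4). The first sum collects the unit cells of [k KL(muhat_s, y)] below the truncation
    level, the second the paths beyond it, which are bounded once per round and dyadic block. *)
Lemma underestimated_pulls a s y (L : nat -> nat) : y < mu s ->
  (forall j, 0 < L j)%N ->
  \sum_(i < n0) pr ([set w | muhat_max (K + i) w <= y] `&` A i a) <=
  \sum_(k < T) (L (trunc_log 2 k.+1))%:R *
    (expR 1 * expR (- (k.+1%:R * ((mu s - y) ^+ 2 / (16 * V))))) +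
  T%:R * \sum_(j < T)
    expR (- ((L j)%:R / 2 + (2 ^ j)%:R * ((mu s - y) ^+ 2 / (16 * V)))).
Proof.
move=> ys L0; set eta := (mu s - y) ^+ 2 / _.
pose Mx i := [set w | muhat_max (K + i) w <= y].
have hMx i : history I r (K + i) (Mx i) by exact: history_muhat_max.
have mMx i : (i < n0)%N -> measurable (Mx i) by move=> ni; exact: mpast ni (hMx i).
(* If [y] is no family mean, an empirical mean of [s] below [y < mu s] contradicts the interval
   property, so the events are null. *)
have [fy|nfy] := pselect (fam y); last first.
  have [G [mG G0 bad]] := bad_null.
  rewrite big1 => [|i _].
    by rewrite addr_ge0// ?mulr_ge0// sumr_ge0// => k _; rewrite ?mulr_ge0 ?expR_ge0.
  have ni := ltn_ord i; apply/eqP; rewrite eq_le pr_ge0 andbT -G0.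
  apply: le_pr => //; first by apply: measurableI; [exact: mMx|exact: mA].
  move=> w [/= my _]; apply: bad => gw; apply: nfy.
  have fs := muhat_family (roundT ni) gw s.
  apply: (family_mean_itv itvTheta Z_gt0_lty varV fs (mu_family s)).
  rewrite (ltW ys) andbT; exact: (muhat_max_leP _ _ _ my).
have /choice[D DP] : forall u : R, exists D : set (measurableTypeR R), 0 <= u ->
    [/\ measurable D,
    forall z, fam z -> z <= y -> ~ D z -> KLm z y <= u &
    forall n, exists E, [/\ measurable E,
      forall t w, (t <= T)%N -> (n <= N t s w)%N -> D (muhat t s w) -> E w &
      pr E <= expR (- (n%:R * (u + eta)))]].
  move=> u; have [u0|u0] := pselect (0 <= u); last by exists set0 => /u0.
  by have [D DP] := level_set fy ys u0; exists D.
pose blk k := trunc_log 2 k.+1.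
(* Counts in block [j] are below [2 ^ j.+1], so outside [D (top j)] the exponent is at most [L j];
   counts are at least [2 ^ j], so inside it the tail bound gains [L j / 2]. *)
pose top j : R := (L j)%:R / (2 ^ j.+1)%:R.
(* The set of means left at level [v], for [k.+1] pulls of [s]; the last level
   depends on [k] through its dyadic block only. *)
pose C k v : set (measurableTypeR R) := if v == 0%N then `]-oo, y]%classic
  else if (v < L (blk k))%N then D (v%:R / k.+1%:R) else D (top (blk k)).
have top0 j : 0 <= top j by rewrite divr_ge0.
have mC k v : measurable (C k v).
  rewrite /C; case: eqP => _; first exact: measurable_itv.
  case: ifP => _; first by have [] := DP (v%:R / k.+1%:R) (divr_ge0 (ler0n _ _) (ler0n _ _)).
  by have [] := DP _ (top0 (blk k)).
pose F k v i := (Mx i `&` [set w | C k v (muhat (K + i) s w)]) `&`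
  ~` [set w | C k v.+1 (muhat (K + i) s w)].
have hF k v i : history I r (K + i) (F k v i).
  apply: history_setI; first by apply: history_setI => //; exact: history_muhat.
  by apply: history_setC; exact: history_muhat.
have mF k v i : (i < n0)%N -> measurable (F k v i).
  by move=> ni; exact: mpast ni (hF k v i).
pose Top i j := [set w | (2 ^ j <= N (K + i) s w)%N] `&`
  [set w | D (top j) (muhat (K + i) s w)].
have mTop i j : (i < n0)%N -> measurable (Top i j).
  move=> ni; apply: (mpast ni); apply: history_setI.
    exact: (@history_count (K + i) s (fun c => (2 ^ j <= c)%N)).
  by apply: history_muhat; have [] := DP _ (top0 j).
pose B k v i := ([set w | N (K + i) s w = k.+1] `&` F k v i).
have hB k v i : history I r (K + i) (B k v i).
  by apply: history_setI => //; exact: history_count_eq.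
have mB k v i b : (i < n0)%N -> measurable (B k v i `&` A i b).
  by move=> ni; apply: measurableI; [exact: mpast ni (hB k v i)|exact: mA].
have cover (i : nat) : (i < n0)%N -> pr (Mx i `&` A i a) <=
    \sum_(k < T) \sum_(v < L (blk k)) pr (B k v i `&` A i a) +
    \sum_(j < T) pr (Top i j).
  move=> ni; pose U := \big[setU/set0]_(j < T) Top i j.
  have mU : measurable U by apply: bigsetU_measurable => j _; exact: mTop.
  have mMA : measurable (Mx i `&` A i a) by apply: measurableI; [exact: mMx|exact: mA].
  have mMU : measurable ((Mx i `&` A i a) `\` U) by exact: measurableD.
  apply: (@le_trans _ _ (pr (((Mx i `&` A i a) `\` U) `|` U))).
    apply: le_pr => //; first exact: measurableU.
    by move=> w MA; have [Uw|nU] := pselect (U w); [right|left].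
  apply: le_trans (pr_setU_le _ mMU mU) _.
  apply: lerD; last first.
    apply: (@le_pr_bigU T (fun j => Top i j)) => //.
      by move=> j _; exact: mTop.
    by move=> w; rewrite /U -bigcup_mkord => -[j jT Tw]; exists j.
  apply: (@le_trans _ _ (\sum_(k < T)
      pr (([set w | N (K + i) s w = k.+1] `&` (Mx i `&` A i a)) `\` U))).
    apply: (@le_pr_bigU T (fun k =>
      ([set w | N (K + i) s w = k.+1] `&` (Mx i `&` A i a)) `\` U)) => //.
      move=> k _; apply: measurableD => //; apply: measurableI => //.
      by apply: (mpast ni); exact: history_count_eq.
    move=> w [[Mw Aw] nU]; have iT := pastT ni.
    have Ngt : (0 < N (K + i) s w)%N.
      by apply: pull_count_gt0; rewrite leq_addr ltnW.
    exists (N (K + i) s w).-1.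
      by rewrite prednK// (leq_trans (pull_count_le _ _ _))// ltnW.
    by split => //; split => //=; rewrite prednK.
  apply: ler_sum => k _.
  apply: (@le_pr_bigU (L (blk k)) (fun v => B k v i `&` A i a)).
  - apply: measurableD => //; apply: measurableI => //.
    by apply: (mpast ni); exact: history_count_eq.
  - by move=> v _; exact: mB.
  move=> w [[/= Nk [Mw Aw]] nU].
  have C0 : C k 0%N (muhat (K + i) s w).
    by rewrite /C eqxx /= in_itv/=; exact: (muhat_max_leP _ _ _ Mw).
  have nCL : ~ C k (L (blk k)) (muhat (K + i) s w).
    rewrite /C gtn_eqF// ltnn => Dw; apply: nU; rewrite /U -bigcup_mkord.
    have bk : (2 ^ blk k <= k.+1)%N by exact: trunc_logP.
    exists (blk k) => /=.
      by rewrite (leq_trans (ltn_expl (blk k) (ltnSn 1)))// (leq_trans bk).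
    by split => //=; rewrite Nk.
  (* The mean starts inside [C k 0] and, off the events [Top], ends outside the last set, so it
     leaves the sequence at some level [v]. *)
  have [v vL [Cv nCv]] :=
    @exit_index (fun v => C k v (muhat (K + i) s w)) (L (blk k)) C0 nCL.
  by exists v.
have cellE k v : (v < L (blk k))%N ->
    \sum_(i < n0) pr (B k v i `&` A i a) <= expR 1 * expR (- (k.+1%:R * eta)).
  move=> vL.
  (* Pulls of [a] are exchanged for pulls of [s] at the price [exp (v + 1)]; the probability of
     reaching level [v] carries [exp (- v)], which leaves a factor [exp 1]. *)
  apply: (@le_trans _ _ (\sum_(i < n0) expR v.+1%:R * pr (B k v i `&` A i s))).
    apply: ler_sum => i _; have ni := ltn_ord i.
    apply: (sampling_ratio (roundT ni) (hB k v i) (expR_gt0 _)).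
    move=> w gw [/= Nk [[Mw Cv] nCv]].
    have fs := muhat_family (roundT ni) gw s.
    have fm := muhat_max_family (roundT ni) gw.
    rewrite /= in fs fm; rewrite ler_expR Nk.
    have sy : muhat (K + i) s w <= y by exact: (muhat_max_leP _ _ _ Mw).
    have sm : muhat (K + i) s w <= muhat_max (K + i) w by exact: max_arm_ge.
    have kl1 := KL_family_mono Z_gt0_lty varV fs fm fy sm Mw.
    apply: (@le_trans _ _ (k.+1%:R * KLm (muhat (K + i) s w) y)).
      by rewrite ler_pM2l// ltr0n.
    move: nCv; rewrite /C /=; case: ifPn => [v1L|].
      have [//|_ Dle _] := DP (v.+1%:R / k.+1%:R).
      move=> /(Dle _ fs sy) kl2.
      by rewrite mulrC -ler_pdivlMr// ltr0n.
    rewrite -leqNgt => Lv; have Lv' : L (blk k) = v.+1.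
      by apply/eqP; rewrite eqn_leq Lv vL.
    have [//|_ Dle _] := DP (top (blk k)).
    move=> /(Dle _ fs sy) kl2.
    apply: (@le_trans _ _ (k.+1%:R * top (blk k))); first by rewrite ler_pM2l// ltr0n.
    rewrite /top Lv' mulrA ler_pdivrMr ?ltr0n ?expn_gt0// mulrC ler_pM2l ?ltr0n//.
    by rewrite ler_nat ltnW// trunc_log_ltn.
  rewrite -mulr_sumr.
  have [E [mE EP prE]] : exists E, [/\ measurable E,
    forall t w, (t <= T)%N -> (k.+1 <= N t s w)%N -> C k v (muhat t s w) -> E w &
    pr E <= expR (- (v%:R + k.+1%:R * eta))].
    (* Level 0 only says that the mean is at most [y]: with [x = y] the divergence in the rate is
       0. *)
    rewrite /C; case: eqP => [->|_].
      have [E [mE EP prE]] := lower_event k.+1 fy fy (lexx y) ys.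
      exists E; split => //.
      by rewrite add0r; move: prE; rewrite (KL_family_refl varV fy) add0r.
    rewrite vL; have [//|_ _ /(_ k.+1)[E [mE EP prE]]] := DP (v%:R / k.+1%:R).
    exists E; split => //; apply: (le_trans prE); rewrite ler_expR lerN2.
    by rewrite mulrDr [X in _ <= X + _]mulrC divfK// pnatr_eq0.
  have : \sum_(i < n0) pr (B k v i `&` A i s) <= pr E.
    apply: (@pulls_at_count s k.+1 (F k v) E (mF k v) mE).
    move=> i w ni Nk [[_ Cw] _]; apply: (EP (K + i)%N) => //; last by rewrite Nk.
    exact/ltnW/pastT.
  move=> /le_trans/(_ prE) h.
  apply: (@le_trans _ _ (expR v.+1%:R * expR (- (v%:R + k.+1%:R * eta)))).
    by rewrite ler_pM2l// expR_gt0.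
  by rewrite -!expRD ler_expR -natr1; lra.
apply: (@le_trans _ _ (\sum_(i < n0) (\sum_(k < T) \sum_(v < L (blk k)) pr (B k v i `&` A i a) +
    \sum_(j < T) pr (Top i j)))).
  by apply: ler_sum => i _; exact: cover.
rewrite big_split/=; apply: lerD.
  rewrite exchange_big/=; apply: ler_sum => k _; rewrite exchange_big/=.
  apply: (@le_trans _ _ (\sum_(v < L (blk k)) expR 1 * expR (- (k.+1%:R * eta)))).
    by apply: ler_sum => v _; exact: cellE.
  by rewrite sumr_const card_ord -[leLHS]mulr_natl.
rewrite exchange_big/= mulr_sumr; apply: ler_sum => j _.
have [//|_ _ /(_ (2 ^ j)%N)[E [mE EP prE]]] := DP (top j).
apply: (@le_trans _ _ (\sum_(i < n0) pr E)).
  apply: ler_sum => i _; have ni := ltn_ord i; apply: le_pr => //; first exact: mTop.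
  by move=> w [/= Nj Dw]; apply: (EP (K + i)%N) => //; exact/ltnW/pastT.
rewrite sumr_const card_ord -[leLHS]mulr_natl; apply: ler_pM => //; first exact: pr_ge0.
  by rewrite ler_nat leq_subr.
apply: (le_trans prE); rewrite ler_expR lerN2 mulrDr lerD2r /top.
have p0 : (2 ^ j)%:R != 0 :> R by rewrite pnatr_eq0 -lt0n expn_gt0.
rewrite expnS natrM le_eqVlt; apply/orP; left; apply/eqP.
by move: p0; set p := _%:R; set l := _%:R => p0; field.
Qed.

Lemma arm_pulls a s eps : 0 < eps -> mu a + 4 * eps = mu s ->
  1 <= T%:R * (eps ^+ 2 / (16 * V)) ->
  \sum_(i < n0) pr (A i a) <=
  2 + (9 * ln (T%:R * (eps ^+ 2 / (16 * V))) + 137) / (eps ^+ 2 / (16 * V)).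
Proof.
move=> e0 gapE; set e := eps ^+ 2 / _ => tau1.
have eta0 : 0 < e by rewrite divr_gt0 ?exprn_gt0// mulr_gt0.
set tau := T%:R * e in tau1 *.
have tau0 : 0 < tau by exact: lt_le_trans tau1.
have lt0 : 0 <= ln tau by exact: ln_ge0.
(* The smallest convenient count with [exp (- u e) <= 1 / tau], so that case (3) costs at most
   [T / tau = 1 / e]. *)
pose u := (Num.truncn (ln tau / e)).+1.
have lu : ln tau / e < u%:R by exact: truncnS_gt.
have ul : u.+1%:R <= ln tau / e + 2.
  have X0 : 0 <= ln tau / e by rewrite divr_ge0// ltW.
  have := truncn_le (ln tau / e); rewrite X0 /u -!natr1; lra.
have ys : mu s - eps < mu s by rewrite gtrBl.
have h1 := few_pulls a u; have h2 := overestimated_pulls a e0.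
have h3' := well_estimated_pulls u e0 gapE.
have h4 := underestimated_pulls a (L := trunc_level tau e) ys (fun j => ltn0Sn _).
rewrite -/e in h2 h3'.
have ye : mu s - (mu s - eps) = eps by rewrite subKr.
rewrite ye -/e in h4.
have h4' := le_trans h4 (truncation_sum eta0 tau1).
have h3 : T%:R * expR (- (u%:R * e)) <= e^-1.
  apply: (@le_trans _ _ (T%:R * expR (- ln tau))).
    rewrite ler_wpM2l// ler_expR lerN2.
    by rewrite -ler_pdivrMr// ltW.
  rewrite expRN lnK ?posrE// /tau invfM mulrA.
  have T0 : T%:R != 0 :> R.
    by apply/eqP => TE; move: tau1; rewrite /tau TE mul0r ler10.
  by rewrite divff ?mul1r.
have mQ i : (i < n0)%N -> measurable [set w | (N (K + i) a w <= u)%N].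
  by move=> ni; apply: (mpast ni); exact: (@history_count (K + i) a (fun c => (c <= u)%N)).
have mX i : (i < n0)%N -> measurable [set w | mu a + eps <= muhat (K + i) a w].
  move=> ni; apply: (mpast ni).
  rewrite (_ : [set w | _] = [set w | `[mu a + eps, +oo[%classic (muhat (K + i) a w)]).
    by apply: history_muhat; exact: measurable_itv.
  by apply/seteqP; split => w; rewrite /= in_itv/= andbT.
have mM i : (i < n0)%N -> measurable [set w | muhat_max (K + i) w <= mu s - eps].
  by move=> ni; apply: (mpast ni); exact: history_muhat_max.
have split4 (i : nat) : (i < n0)%N -> pr (A i a) <=
    pr ([set w | (N (K + i) a w <= u)%N] `&` A i a) +
    (pr ([set w | mu a + eps <= muhat (K + i) a w] `&` A i a) +
    (pr ((([set w | (u < N (K + i) a w)%N] `&`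
     ~` [set w | mu a + eps <= muhat (K + i) a w]) `&`
     ~` [set w | muhat_max (K + i) w <= mu s - eps]) `&` A i a) +
    pr ([set w | muhat_max (K + i) w <= mu s - eps] `&` A i a))).
  move=> ni; have mAi := mA a ni.
  have m1 := measurableI _ _ (mQ i ni) mAi; have m2 := measurableI _ _ (mX i ni) mAi.
  have m4 := measurableI _ _ (mM i ni) mAi.
  have mQ' : measurable [set w | (u < N (K + i) a w)%N].
    by apply: (mpast ni); exact: (@history_count (K + i) a (fun c => (u < c)%N)).
  have m3 := measurableI _ _ (measurableI _ _ (measurableI _ _ mQ'
    (measurableC (mX i ni))) (measurableC (mM i ni))) mAi.
  have m34 := measurableU _ _ m3 m4; have m234 := measurableU _ _ m2 m34.
  have m1234 := measurableU _ _ m1 m234.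
  set X1 := (X in _ <= pr X + _); set X2 := (X in _ <= _ + (pr X + _)).
  set X3 := (X in _ <= _ + (_ + (pr X + _))).
  set X4 := (X in _ <= _ + (_ + (_ + pr X))).
  apply: (@le_trans _ _ (pr (X1 `|` (X2 `|` (X3 `|` X4))))).
    apply: le_pr => //.
    move=> w Aw; have [Nu|Nu] := leqP (N (K + i) a w) u; first by left.
    right; have [xm|xm] := pselect (mu a + eps <= muhat (K + i) a w); first by left.
    right; have [my|my] := pselect (muhat_max (K + i) w <= mu s - eps); last by left.
    by right.
  apply: (le_trans (pr_setU_le _ m1 m234)); rewrite lerD2l.
  apply: (le_trans (pr_setU_le _ m2 m34)); rewrite lerD2l.
  exact: (pr_setU_le _ m3 m4).
apply: (@le_trans _ _ (u.+1%:R + (e^-1 + (e^-1 + (8 * ln tau + 134) / e)))).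
  apply: le_trans (ler_sum _ _) _.
    by move=> i _; exact: split4 (ltn_ord i).
  rewrite !big_split/=; apply: lerD => //; apply: lerD => //; apply: lerD => //.
  exact: le_trans h3' h3.
(* The sum of the four cases needs [9 ln tau + 136]; the spare [1 / e] is nonnegative. *)
have -> : (9 * ln tau + 137) / e = ln tau / e + (e^-1 + (e^-1 + (8 * ln tau + 134) / e)) + e^-1.
  by field; rewrite gt_eqF.
have : 0 <= e^-1 by rewrite invr_ge0 ltW.
move: ul; set p := u.+1%:R; set q := (_ + (_ + _)); lra.
Qed.

(** * From expected pulls to the regret *)

Lemma gap_ge0 a : 0 <= gap nu a.
Proof. by rewrite /gap subr_ge0; exact: (max_arm_ge (fun a => mu a)). Qed.

Lemma regretE : regret P nu T I =
  (\sum_(i < T) \sum_(a < K) gap nu a * pr (I i.+1 @^-1` [set a]))%:E.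
Proof.
have mI (i : 'I_T) a : measurable (I i.+1 @^-1` [set a]).
  by apply: (pull_event_measurable inter); rewrite /= ltn_ord.
have mind (i : 'I_T) a : measurable_fun [set: Omega]
    (fun w => (gap nu a * \1_(I i.+1 @^-1` [set a]) w)%:E).
  by apply/measurable_EFinP; apply: measurable_funM => //; exact: measurable_indic.
have ind0 (i : 'I_T) a w : (0 <= (gap nu a * \1_(I i.+1 @^-1` [set a]) w)%:E)%E.
  by rewrite lee_fin mulr_ge0 ?gap_ge0.
have gapE w (i : 'I_T) : gap nu (I i.+1 w) =
    \sum_(a < K) gap nu a * \1_(I i.+1 @^-1` [set a]) w.
  rewrite (bigD1 (I i.+1 w))//= big1 ?addr0 => [|a aI].
    by rewrite indicE mem_set ?mulr1.
  by rewrite indicE memNset ?mulr0// => /= E; rewrite E eqxx in aI.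
rewrite /regret expectation.unlock.
under eq_integral do rewrite big_add1 big_mkord.
under eq_integral => w _ do under eq_bigr => i _ do rewrite gapE.
rewrite -sumEFin.
under eq_integral => w _ do rewrite -sumEFin.
rewrite ge0_integral_sum//; last 2 first.
- move=> i; rewrite (_ : (fun _ => _) = (fun w => \sum_(a < K)
    (gap nu a * \1_(I i.+1 @^-1` [set a]) w)%:E)%E).
    exact: emeasurable_sum.
  by apply/funext => w; rewrite -sumEFin.
- by move=> i w _; rewrite -sumEFin; apply: sume_ge0 => a _.
apply: eq_bigr => i _; rewrite -sumEFin.
under eq_integral do rewrite -sumEFin.
rewrite ge0_integral_sum//.
apply: eq_bigr => a _.
under eq_integral do rewrite EFinM.
rewrite ge0_integralZl//; last 2 first.
- by apply/measurable_EFinP; exact: measurable_indic.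
- by rewrite lee_fin gap_ge0.
rewrite integral_indic// setIT EFinM; congr (_ * _)%E; exact: prE.
Qed.

Lemma first_rounds a : \sum_(i < minn K T) pr (I i.+1 @^-1` [set a]) <= 1.
Proof.
apply: le_trans (pr_le1 P measurableT).
have iKT i : (i < minn K T)%N -> (i < K)%N /\ (i < T)%N.
  by rewrite leq_min => /andP[].
apply: (@pr_sum_disjoint _ _ _ P _ (fun i => I i.+1 @^-1` [set a]) setT) => //.
- by move=> i /iKT[_ iT]; exact: (pull_event_measurable inter).
- move=> i j w /andP[ij /iKT[jK jT]] /= Ii Ij.
  have iE : I i.+1 w = i :> nat.
    by rewrite follows.1//= (ltn_trans ij).
  have jE : I j.+1 w = j :> nat by rewrite follows.1.
  by move: ij; rewrite -{1}iE -{1}jE Ii Ij ltnn.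
Qed.

Lemma pulls_sum_le i : (i < n0)%N -> \sum_(a < K) pr (A i a) <= 1.
Proof.
move=> ni; apply: le_trans (pr_le1 P measurableT).
pose B (k : nat) := [set w | I (K + i).+1 w = k :> nat].
have BE (a : 'I_K) : A i a = B a.
  by apply/seteqP; split => w; rewrite /A /B /=; [move=> ->|exact: val_inj].
under eq_bigr do rewrite BE.
apply: (@pr_sum_disjoint _ _ _ P _ B setT) => //.
- by move=> k kK; rewrite -[k]/(nat_of_ord (Ordinal kK)) -BE; exact: mA.
- by move=> k l w /andP[kl _]; rewrite /B /= => -> kE; rewrite kE ltnn in kl.
Qed.

Lemma regret_bound : (regret P nu T I <=
  (5264 * (Num.sqrt (V * K%:R * T%:R * ln K%:R) + \sum_(a < K) gap nu a))%:E)%E.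
Proof.
have [s sE] := max_arm_ex (fun a => mu a) K0.
have gap0 := gap_ge0.
pose S a := \sum_(i < n0) pr (A i a).
have S0 a : 0 <= S a by apply: sumr_ge0 => i _; exact: pr_ge0.
have K2R : 2 <= K%:R :> R by rewrite ler_nat.
have K0R : 0 < K%:R :> R by rewrite ltr0n.
have lnK := ln_ge_half K2R; have lnK0 : 0 < ln K%:R :> R by lra.
have regS : regret P nu T I =
    (\sum_(a < K) gap nu a * \sum_(i < minn K T) pr (I i.+1 @^-1` [set a]) +
     \sum_(a < K) gap nu a * S a)%:E.
  rewrite regretE; congr EFin.
  (* Also correct for [T < K], where [n0 = 0] and all rounds are initial. *)
  have TE : (T = minn K T + n0)%N by rewrite /n0; lia.
  rewrite -(big_mkord xpredT (fun i => \sum_(a < K) gap nu a * pr (I i.+1 @^-1` [set a]))).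
  rewrite (@big_cat_nat _ _ _ (minn K T))//=; last by rewrite geq_minr.
  congr (_ + _).
    rewrite big_mkord exchange_big/=; apply: eq_bigr => a _.
    by rewrite mulr_sumr.
  rewrite -{1}[minn K T]add0n big_addn (_ : (T - minn K T)%N = n0); last first.
    by rewrite /n0; lia.
  rewrite big_mkord exchange_big/=; apply: eq_bigr => a _.
  rewrite mulr_sumr; apply: eq_bigr => i _; rewrite /A.
  have -> : (i + minn K T)%N = (K + i)%N by have := ltn_ord i; rewrite /n0; lia.
  by [].
rewrite regS lee_fin.
set q := Num.sqrt (V * K%:R * T%:R * ln K%:R).
have q0 : 0 <= q by exact: sqrtr_ge0.
have first_le : \sum_(a < K) gap nu a * \sum_(i < minn K T) pr (I i.+1 @^-1` [set a])
    <= \sum_(a < K) gap nu a.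
  by apply: ler_sum => a _; rewrite ler_piMr// first_rounds.
have G0 : 0 <= \sum_(a < K) gap nu a by apply: sumr_ge0.
suff second_le : \sum_(a < K) gap nu a * S a <= 2 * \sum_(a < K) gap nu a + 5264 * q.
  lra.
have [T0|T0] := posnP T.
  have n00 : n0 = 0%N by rewrite /n0 T0 sub0n.
  rewrite big1 => [|a _]; last by rewrite /S n00 big_ord0 mulr0.
  by move: G0 q0; lra.
have T0R : 0 < T%:R :> R by rewrite ltr0n.
pose D0 := 16 * Num.sqrt (V * K%:R * ln K%:R / T%:R).
have D00 : 0 <= D0 by rewrite mulr_ge0 ?sqrtr_ge0.
pose B := 5248 * (Num.sqrt (V * T%:R) * (ln K%:R / Num.sqrt (K%:R * ln K%:R))).
have B0 : 0 <= B.
  apply: mulr_ge0; first by lra.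
  by rewrite mulr_ge0 ?sqrtr_ge0// divr_ge0 ?sqrtr_ge0 ?ltW.
have arm a : gap nu a * S a <= 2 * gap nu a + D0 * S a + B.
  (* Arms with gap at most [D0] are charged [D0] per pull, over at most [T] pulls in all; each other
     arm costs at most [2 * gap nu a + B]. *)
  have [gD|Dg] := leP (gap nu a) D0.
    have : gap nu a * S a <= D0 * S a by rewrite ler_wpM2r.
    by have := gap0 a; lra.
  have g0 : 0 < gap nu a by exact: le_lt_trans Dg.
  have [tau1 term] := arm_term V0 T0R K2R Dg.
  have eps0 : 0 < gap nu a / 4 by rewrite divr_gt0.
  have gE : mu a + 4 * (gap nu a / 4) = mu s.
    by rewrite mulrC divfK// /gap sE subrKC.
  have h := arm_pulls eps0 gE tau1.
  apply: (le_trans (ler_wpM2l (ltW g0) h)); rewrite mulrDr.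
  by have := mulr_ge0 D00 (S0 a); move: term; rewrite -/B; lra.
apply: (@le_trans _ _ (\sum_(a < K) (2 * gap nu a + D0 * S a + B))).
  by apply: ler_sum => a _; exact: arm.
have -> : \sum_(a < K) (2 * gap nu a + D0 * S a + B) =
    2 * \sum_(a < K) gap nu a + D0 * \sum_(a < K) S a + B *+ K.
  by rewrite [LHS]big_split/= [X in X + _ = _]big_split/= sumr_const card_ord !mulr_sumr.
have sumS : \sum_(a < K) S a <= T%:R.
  rewrite /S exchange_big/= (@le_trans _ _ (\sum_(i < n0) 1))//.
    by apply: ler_sum => i _; exact: pulls_sum_le (ltn_ord i).
  by rewrite sumr_const card_ord ler_nat leq_subr.
have KT0 : 0 <= V * K%:R * ln K%:R / T%:R.
  by rewrite !mulr_ge0 ?invr_ge0 ?(ltW V0) ?(ltW lnK0).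
have T_neq0 : T%:R != 0 :> R by rewrite gt_eqF.
have D0T : D0 * T%:R = 16 * q.
  rewrite /D0 -mulrA; congr (_ * _); rewrite /q.
  rewrite (_ : V * K%:R * T%:R * ln K%:R = V * K%:R * ln K%:R / T%:R * T%:R ^+ 2).
    by rewrite [RHS]sqrtrM// sqrtr_sqr ger0_norm.
  by move: T_neq0; set t := T%:R; set k := K%:R; set l := ln k => t0; field.
have KB : B *+ K = 5248 * q.
  have kl0 : 0 < K%:R * ln K%:R :> R by rewrite mulr_gt0.
  have p2 := sqr_sqrtr (ltW kl0).
  have p0 : Num.sqrt (K%:R * ln K%:R) != 0 :> R by rewrite gt_eqF// sqrtr_gt0.
  rewrite -mulr_natr /B -mulrA; congr (_ * _); rewrite /q.
  rewrite (_ : V * K%:R * T%:R * ln K%:R = V * T%:R * (K%:R * ln K%:R)); last by ring.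
  rewrite [RHS]sqrtrM ?mulr_ge0 ?(ltW V0)// -mulrA; congr (_ * _).
  apply: (mulIf p0); rewrite -[RHS]expr2 p2.
  by rewrite mulrAC divfK// mulrC.
have D0S : D0 * \sum_(a < K) S a <= 16 * q by rewrite -D0T ler_wpM2l.
rewrite KB -addrA lerD2l; apply: le_trans (lerD D0S (lexx _)) _.
by rewrite -mulrDl; apply: ler_wpM2r => //; lra.
Qed.
End algorithm.

Theorem corollary5 (R : realType) :
  exists2 C : R, 0 < C &
  forall (m : {measure set (measurableTypeR R) -> \bar R}) (Theta : set R)
    (V : R) (K T : nat) (nu : 'I_K -> probability (measurableTypeR R) R)
    (d : measure_display) (Omega : measurableType d) (P : probability Omega R)
    (I : nat -> Omega -> 'I_K) (r : nat -> Omega -> R),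
  (2 <= K)%N ->
  is_interval Theta ->
  (forall theta, Theta theta -> (0 < partition_fun m theta < +oo)%E) ->
  (forall theta, Theta theta -> derivable_within Theta (log_partition m) theta) ->
  (forall theta, Theta theta ->
     derivable_within Theta (derive_within Theta (log_partition m)) theta) ->
  {within Theta, continuous
     (derive_within Theta (derive_within Theta (log_partition m)))} ->
  (forall theta, Theta theta ->
     0 < derive_within Theta (derive_within Theta (log_partition m)) theta) ->
  (forall q, exp_family m Theta q -> ('V_q[(fun x => x)] <= V%:E)%E) ->
  (forall a, exp_family m Theta (nu a)) ->
  bandit_interaction P nu T I r ->
  follows_exp_KL_MS m Theta P T I r ->
  emp_means_in_family m Theta P T I r ->
  (regret P nu T I <=
     (C * (Num.sqrt (V * K%:R * T%:R * ln K%:R) + \sum_(a < K) gap nu a))%:E)%E.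
Proof.
(* [5264 = 16 + 5248]: the small gaps contribute [D0 * T = 16 q], the large ones [K] times [B], that
   is [5248 q], where [q] is the square root in the bound. *)
exists 5264; first by lra.
move=> m Theta V K T nu d Omega P I r K2 itvTheta Z01 _ _ _ _ varV nuF
  inter follows means_in.
(* Two different means would force [V > 0]; when [V <= 0] all gaps vanish and the regret is 0. *)
have [V0|V_le0] := ltP 0 V.
  exact: (regret_bound K2 itvTheta Z01 varV nuF inter follows means_in V0).
have gap0 a : gap nu a = 0.
  have [s sE] := max_arm_ex (fun a => mean (nu a)) (ltnW K2).
  rewrite /gap sE; apply/eqP; rewrite subr_eq0; apply/negPn/negP => neq.
  have := variance_bound_gt0 itvTheta Z01 varV (nuF s) (nuF a) neq.
  by rewrite ltNge V_le0.
rewrite big1// addr0 /regret (_ : (fun w => _) = cst 0).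
  rewrite expectation_cst lee_fin; apply: mulr_ge0; last exact: sqrtr_ge0.
  by lra.
by apply/funext => w; rewrite big1.
Qed.
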